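(* There exist a nonempty compact set $E \subset \mathbb{R}^2$ and $\varepsilon > 0$ such that the boundary $\partial E_\varepsilon$ of the closed $\varepsilon$-neighbourhood $E_\varepsilon$ of $E$ satisfies: (i) every point of $\partial E_\varepsilon$ is either a wedge or a shallow singularity; and (ii) there exists a subset $C \subset \partial E_\varepsilon$ with positive Hausdorff dimension such that curvature of $\partial E_\varepsilon$ is not defined in the classical sense at any point of $C$.
   Context: For $E \subset \mathbb{R}^2$ and $\varepsilon > 0$, the closed $\varepsilon$-neighbourhood of $E$ is $E_\varepsilon := \overline{\bigcup_{x \in E} B_\varepsilon(x)}$, where $B_\varepsilon(x)$ is the open Euclidean ball of radius $\varepsilon$ centred at $x$ and the overline denotes closure. A boundary point $x \in \partial E_\varepsilon$ is smooth if there exist $\delta > 0$ and a $C^1$-curve $\Gamma$ with $\Gamma = \partial E_\varepsilon \cap \overline{B_\delta(x)}$; if $x$ is not smooth, it is called a singularity. The tangential directions of $\partial E_\varepsilon$ at $x \in \partial E_\varepsilon$ are the unit vectors that arise as limits of $(x_n - x)/\|x_n - x\|$ for sequences $x_n \in \partial E_\varepsilon \setminus \{x\}$ with $x_n \to x$. A singularity $x \in \partial E_\varepsilon$ is a wedge if there are exactly two tangential directions at $x$ and the angle $\theta$ between them satisfies $\theta \in (0, \pi)$. A singularity $x \in \partial E_\varepsilon$ is a shallow singularity if the tangential directions at $x$ are exactly two opposite vectors $u, -u$ (so $\partial E_\varepsilon$ has a tangent line at $x$) and $x$ is an accumulation point of wedges of $\partial E_\varepsilon$ (from one side or from both sides along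 the boundary). Curvature of $\partial E_\varepsilon$ is defined at $x \in \partial E_\varepsilon$ if there are Cartesian coordinates centred at $x$ in which $\partial E_\varepsilon$ coincides near $x$ with the graph of a Lipschitz function $h$, differentiable at $0$ with $h(0) = h'(0) = 0$, such that the second derivative of $h$ at $0$ exists, in the sense that $\big(h'(t) - h'(0)\big)/t$ has a finite limit as $t \to 0$, $t \neq 0$, through the points $t$ at which $h$ is differentiable. (The first derivative is only required to exist at almost every $t$, since wedges may be dense.) *)

(* Defs.v *)
From HB Require Import structures.
From mathcomp Require Import all_boot all_order all_algebra.
From mathcomp Require Import all_classical all_reals all_analysis.

Set Implicit Arguments.
Unset Strict Implicit.
Unset Printing Implicit Defensive.

Import Order.TTheory GRing.Theory Num.Theory.
Import numFieldNormedType.Exports.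

Local Open Scope classical_set_scope.
Local Open Scope ring_scope.

Section plane.
Context {R : realType}.

(* The library norm on [R * R] is the sup norm.  It is only used through the
   topology it induces (the usual one); every metric notion below is built on
   the Euclidean norm [enorm]. *)
Local Notation plane := (R * R)%type.

Definition dot (u v : plane) : R := u.1 * v.1 + u.2 * v.2.

Definition enorm (u : plane) : R := Num.sqrt (dot u u).

Definition eball (x : plane) (r : R) : set plane :=
  [set y | enorm (y - x) < r].

Definition closed_eps_nbhd (eps : R) (E : set plane) : set plane :=
  closure (\bigcup_(x in E) eball x eps).

Definition boundary (A : set plane) : set plane := closure A `\` interior A.

(* Compact, embedded, regular C^1 arcs.  Requiring [g] to be C^1 on the whole
   line is no restriction: a C^1 map on a segment (with one-sided derivatives
   at the endpoints) extends to a C^1 map on the line. *)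
Definition C1_curve (G : set plane) : Prop :=
  exists (a b : R) (g : R -> plane),
    [/\ a < b,
        (forall t : R, derivable g t 1) /\ continuous (g^`())%classic,
        {in `[a, b] &, injective g},
        {in `[a, b], forall t : R, (g^`())%classic t != 0} &
        G = g @` `[a, b]].

(* In the definitions below, [S] stands for the boundary of a closed
   neighbourhood. *)

Definition smooth_point (S : set plane) (x : plane) : Prop :=
  S x /\ exists2 delta : R, 0 < delta &
    exists2 G : set plane, C1_curve G & G = S `&` closure (eball x delta).

Definition singularity (S : set plane) (x : plane) : Prop :=
  S x /\ ~ smooth_point S x.

Definition tangential_directions (S : set plane) (x : plane) : set plane :=
  [set v | enorm v = 1 /\
    exists u : nat -> plane,
      [/\ forall n, (S `\ x) (u n),
          u n @[n --> \oo] --> x &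
          (enorm (u n - x))^-1 *: (u n - x) @[n --> \oo] --> v]].

Definition angle (u v : plane) : R := acos (dot u v / (enorm u * enorm v)).

Definition wedge (S : set plane) (x : plane) : Prop :=
  singularity S x /\
  exists u v : plane,
    [/\ u != v, tangential_directions S x = [set u; v] &
        0 < angle u v < pi].

(* Accumulation "from one side or from both sides" imposes nothing beyond
   accumulation in the plane: as [u] and [- u] are the only tangential
   directions, wedges converging to [x] subconverge in direction to one of
   them. *)
Definition shallow_singularity (S : set plane) (x : plane) : Prop :=
  [/\ singularity S x,
      exists u : plane, tangential_directions S x = [set u; - u] &
      limit_point [set w | wedge S w] x].

(* [x + s *: e1 + t *: e2] is the point with coordinates [(s, t)] in the
   Cartesian frame [(e1, e2)] centred at [x].  Taking [h] to be Lipschitz on the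
   whole line is no restriction: a Lipschitz function on an interval extends
   with the same constant, and only points near [x] matter. *)
Definition curvature_defined (S : set plane) (x : plane) : Prop :=
  exists (e1 e2 : plane) (h : R -> R),
    [/\ [/\ enorm e1 = 1, enorm e2 = 1 & dot e1 e2 = 0],
        exists2 r : R, 0 < r &
          S `&` eball x r =
          range (fun t : R => x + t *: e1 + h t *: e2) `&` eball x r,
        lipschitz h,
        [/\ h 0 = 0, derivable h 0 1 & (h^`())%classic 0 = 0] &
        exists l : R,
          ((h^`())%classic t - (h^`())%classic 0) / t
            @[t --> within [set t : R | derivable h t 1] 0^'] --> l].

Local Open Scope ereal_scope.

(* The supremum is [-oo] on the empty set. *)
Definition diam (U : set plane) : \bar R :=
  ereal_sup [set (enorm (p - q))%:E | p in U & q in U].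

(* Empty pieces are dropped from the sum since [poweR] maps any base to [1]
   when [s = 0]. *)
Definition hausdorff_content (s delta : R) (A : set plane) : \bar R :=
  ereal_inf [set \sum_(k <oo | U k != set0) poweR (diam (U k)) s
            | U in [set U : (set plane)^nat |
                     A `<=` \bigcup_k U k /\
                     forall k, diam (U k) <= delta%:E]].

Definition hausdorff_measure (s : R) (A : set plane) : \bar R :=
  ereal_sup [set hausdorff_content s delta A
            | delta in [set delta : R | (0 < delta)%R]].

Definition hausdorff_dim (A : set plane) : \bar R :=
  ereal_inf [set s%:E | s in [set s : R | (0 <= s)%R /\
                                          hausdorff_measure s A = 0]].

End plane.

(* Main.v *)
Require Import Defs.
From HB Require Import structures.
From mathcomp Require Import all_boot all_order all_algebra.
From mathcomp Require Import all_classical all_reals all_analysis.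
From mathcomp Require Import ring lra zify.

Set Implicit Arguments.
Unset Strict Implicit.
Unset Printing Implicit Defensive.

Import Order.TTheory GRing.Theory Num.Theory.
Import numFieldNormedType.Exports.

Local Open Scope classical_set_scope.
Local Open Scope ring_scope.

(** The set [E] is chosen so that its closed [1/2]-neighbourhood is
    [{(x, y) : y^2 <= 1 - x^2 + k x}] for a convex function [k] with small
    Lipschitz constant, vanishing at [-1] and [1].  Replacing [k] by one of its
    tangent lines turns this region into a disc of radius at least [1/2], so it
    is a union of discs of radius [1/2].  Above a kink of [k] the boundary has a
    wedge; above any other point, and at the two ends of the region, it has a
    tangent line.  If the kinks are dense, the latter points are limits of
    wedges and hence shallow singularities.

    If the curvature is defined at a boundary point, a mean value inequality
    with a countable exceptional set shows that the boundary leaves its tangent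
    line only quadratically, so that the second differences of [k] with step [t]
    are [O(t^2)] at the abscissa [x] of that point.  This fails if for every [M]
    there is a kink of size more than [M r] at some distance [r] from [x].
    Summing [|x - q|] with weights [3^-m] over [O(2^m)] kinks [q] of level [m],
    one gets such behaviour at all points that are approximated by kinks of
    level [m] up to [4^-m], and these fill a Cantor-like set of positive
    dimension. *)

(** * Euclidean geometry of the plane *)

Section plane_geometry.
Context {R : realType}.
Local Notation plane := (R * R)%type.
Implicit Types (u v x y : plane).

(** Every boundary point of [E_eps] lies on a closed disc of radius [eps] contained in [E_eps], so
    wedges can only be re-entrant; this is why [k] is convex rather than concave.

    The definition of curvature leaves the frame free and controls [h'] only where it exists.
    Differentiability of [h] away from countably many parameters is therefore recovered from the
    tangent lines of the boundary, and the resulting flatness is stated without coordinates before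
    it is read off in the coordinate [x].

    Second differences suit an infinite sum of kinks: they are nonnegative for convex functions, so
    those of the sum dominate those of each single term, and no derivative of the sum has to be
    computed.

    The dimension is bounded below through a parametrisation of the set by [[0, 1]] with Hoelder
    continuous inverse. Covers of the set then pull back to covers of [[0, 1]], and Lebesgue measure
    on the parameters takes the place of a measure on the set. *)

Definition cross u v : R := u.1 * v.2 - u.2 * v.1.

Lemma dot_ge0 u : 0 <= dot u u.
Proof. by rewrite /dot -!expr2 addr_ge0 // sqr_ge0. Qed.

Lemma enorm_ge0 u : 0 <= enorm u.
Proof. exact: sqrtr_ge0. Qed.

Lemma sqr_enorm u : enorm u ^+ 2 = u.1 ^+ 2 + u.2 ^+ 2.
Proof. by rewrite /enorm sqr_sqrtr ?dot_ge0 // /dot !expr2. Qed.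

Lemma enorm_eq0 u : (enorm u == 0) = (u == 0).
Proof.
case: u => a b; rewrite -sqrf_eq0 sqr_enorm /= paddr_eq0 ?sqr_ge0 //.
by rewrite !sqrf_eq0.
Qed.

Lemma enorm_gt0 u : (0 < enorm u) = (u != 0).
Proof. by rewrite lt_def enorm_ge0 andbT enorm_eq0. Qed.

Lemma enorm0 : enorm (0 : plane) = 0.
Proof. by apply/eqP; rewrite enorm_eq0. Qed.

Lemma enormZ (a : R) u : enorm (a *: u) = `|a| * enorm u.
Proof.
apply/eqP; rewrite -(eqrXn2 (n := 2)) ?mulr_ge0 ?enorm_ge0 //.
by rewrite exprMn !sqr_enorm real_normK ?num_real // mulrDr /= -!exprMn.
Qed.

Lemma enormN u : enorm (- u) = enorm u.
Proof. by rewrite -scaleN1r enormZ normrN1 mul1r. Qed.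

Lemma enorm_distC u v : enorm (u - v) = enorm (v - u).
Proof. by rewrite -enormN opprB. Qed.

Lemma enorm_unit u : u != 0 -> enorm ((enorm u)^-1 *: u) = 1.
Proof.
by move=> u0; rewrite enormZ ger0_norm ?invr_ge0 ?enorm_ge0 // mulVf ?enorm_eq0.
Qed.

(** Lagrange's identity. It yields Cauchy-Schwarz, and it shows that non-parallel unit vectors have
    a dot product strictly between -1 and 1. *)
Lemma sqr_dot_cross u v :
  dot u v ^+ 2 + cross u v ^+ 2 = (enorm u * enorm v) ^+ 2.
Proof. by rewrite exprMn !sqr_enorm /dot /cross; ring. Qed.

Lemma normr_dot_le u v : `|dot u v| <= enorm u * enorm v.
Proof.
rewrite -(ler_pXn2r (n := 2)) ?nnegrE ?mulr_ge0 ?enorm_ge0 //.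
by rewrite -sqr_dot_cross real_normK ?num_real // lerDl sqr_ge0.
Qed.

Lemma ler_enormD u v : enorm (u + v) <= enorm u + enorm v.
Proof.
rewrite -(ler_pXn2r (n := 2)) ?nnegrE ?addr_ge0 ?enorm_ge0 //.
rewrite sqrrD !sqr_enorm.
have := le_trans (ler_norm _) (normr_dot_le u v).
by rewrite /dot /=; lra.
Qed.

Lemma ler_fst_enorm u : `|u.1| <= enorm u.
Proof.
rewrite -(ler_pXn2r (n := 2)) ?nnegrE ?enorm_ge0 //.
by rewrite sqr_enorm real_normK ?num_real // lerDl sqr_ge0.
Qed.

Lemma ler_snd_enorm u : `|u.2| <= enorm u.
Proof.
rewrite -(ler_pXn2r (n := 2)) ?nnegrE ?enorm_ge0 //.
by rewrite sqr_enorm real_normK ?num_real // lerDr sqr_ge0.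
Qed.

Lemma enorm_leD u : enorm u <= `|u.1| + `|u.2|.
Proof.
rewrite -(ler_pXn2r (n := 2)) ?nnegrE ?addr_ge0 ?enorm_ge0 //.
rewrite sqrrD sqr_enorm !real_normK ?num_real //.
have := mulr_ge0 (normr_ge0 u.1) (normr_ge0 u.2); lra.
Qed.

Lemma cvg_fst_snd {T : Type} {F : set_system T} {FF : Filter F}
    (f : T -> plane) (l : plane) :
  f t @[t --> F] --> l <->
  (f t).1 @[t --> F] --> l.1 /\ (f t).2 @[t --> F] --> l.2.
Proof.
split=> [fl|[f1 f2]].
  split; first exact: cvg_comp fl (@cvg_fst _ _ _ _ _).
  exact: cvg_comp fl (@cvg_snd _ _ _ _ _).
case: l f1 f2 => a b /= f1 f2.
have h : ((f t).1, (f t).2) @[t --> F] --> (a, b) := cvg_pair f1 f2.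
suff -> : f = (fun t => ((f t).1, (f t).2)) by exact: h.
by apply/funext => t; case: (f t).
Qed.

Lemma cvg_enorm {T : Type} {F : set_system T} {FF : Filter F}
    (f : T -> plane) (l : plane) :
  f t @[t --> F] --> l -> enorm (f t) @[t --> F] --> enorm l.
Proof.
move=> /cvg_fst_snd[f1 f2].
have h : dot (f t) (f t) @[t --> F] --> dot l l by apply: cvgD; apply: cvgM.
exact: cvg_comp h (@sqrt_continuous R (dot l l)).
Qed.

Lemma nbhs_eball x (r : R) : 0 < r -> nbhs x (eball x r).
Proof.
move=> r0; have : enorm (y - x) @[y --> x] --> (0 : R).
  by rewrite -enorm0 -(subrr x); apply: cvg_enorm; apply: cvgB;
    [exact: cvg_id|exact: cvg_cst].
by move=> /cvgr_lt; apply.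
Qed.

Lemma eball_nbhs x (U : set plane) :
  nbhs x U -> exists2 r : R, 0 < r & eball x r `<=` U.
Proof.
move=> /nbhs_ballP[e /= e0 xeU]; exists e => // y xy; apply: xeU.
split; rewrite /ball /= distrC; apply: le_lt_trans xy.
  exact: ler_fst_enorm (y - x).
exact: ler_snd_enorm (y - x).
Qed.

End plane_geometry.

(** * Tangential directions and wedges *)

Section tangents.
Context {R : realType}.
Local Notation plane := (R * R)%type.
Implicit Types (S : set plane) (u v x y : plane).

(** Dividing by the length of [y - x] turns smallness of [F] along [S] into vanishing on limit
    directions. Only positive homogeneity is assumed because one-sided derivatives will occur in
    [F]. *)
Lemma tangential_homogeneous_eq0 S x (F : plane -> R) v :
  continuous F -> (forall (a : R) u, 0 <= a -> F (a *: u) = a * F u) ->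
  (forall e : R, 0 < e -> exists2 d : R, 0 < d &
     forall y, S y -> enorm (y - x) < d -> `|F (y - x)| <= e * enorm (y - x)) ->
  tangential_directions S x v -> F v = 0.
Proof.
move=> cF homF smallF [_ [u [Su ux uv]]].
have Fuv : F ((enorm (u n - x))^-1 *: (u n - x)) @[n --> \oo] --> F v.
  exact: cvg_comp uv (cF v).
have /cvg_lim : F ((enorm (u n - x))^-1 *: (u n - x)) @[n --> \oo] --> 0.
  apply/cvgr0Pnorm_le => e e0; have [d d0 dF] := smallF e e0.
  near=> n; have [Sun /eqP unx] := Su n.
  have u0 : 0 < enorm (u n - x) by rewrite enorm_gt0 subr_eq0.
  rewrite homF ?invr_ge0 ?enorm_ge0 // normrM ger0_norm ?invr_ge0 ?enorm_ge0 //.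
  rewrite ler_pdivrMl // mulrC; apply: dF => //.
  by near: n; exact: ux (nbhs_eball _ d0).
by move=> <- //; apply/esym/cvg_lim.
Unshelve. all: by end_near. Qed.

(** Normalising cancels the positive scale [tau n], so any convenient scale may be used in place of
    the distance to [x]. *)
Lemma tangential_intro S x (u d : nat -> plane) (tau : nat -> R) (l : plane) :
  (forall n, S (u n)) -> (forall n, 0 < tau n) -> tau n @[n --> \oo] --> 0 ->
  (forall n, d n != 0) -> (forall n, u n = x + tau n *: d n) ->
  d n @[n --> \oo] --> l -> l != 0 ->
  tangential_directions S x ((enorm l)^-1 *: l).
Proof.
move=> Su tau0 taul dn0 uE dl l0; split; first exact: enorm_unit.
exists u; split.
- move=> n; split => //= unx; have := dn0 n.
  move/eqP: (uE n); rewrite unx -[X in X == _]addr0 (can_eq (addKr _)) eq_sym.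
  by rewrite scaler_eq0 (gt_eqF (tau0 n)) /= => ->.
- have -> : u = (fun n => x + tau n *: d n) by apply/funext.
  suff : x + tau n *: d n @[n --> \oo] --> x + 0 *: l by rewrite scale0r addr0.
  by apply: cvgD; [exact: cvg_cst|exact: cvgZ].
- have -> : (fun n => (enorm (u n - x))^-1 *: (u n - x)) =
            (fun n => (enorm (d n))^-1 *: d n).
    apply/funext => n; rewrite uE addrAC subrr add0r enormZ gtr0_norm //.
    rewrite invfM scalerA -mulrA mulrCA mulVf ?gt_eqF //.
    by rewrite mulr1.
  apply: cvgZ => //; apply: cvgV; last exact: cvg_enorm.
  by rewrite enorm_eq0.
Qed.

Lemma tangential_local S1 S2 x (r : R) : 0 < r ->
  S1 `&` eball x r = S2 `&` eball x r ->
  tangential_directions S1 x `<=` tangential_directions S2 x.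
Proof.
move=> r0 S12 v [v1 [u [Su ux uv]]]; split => //.
have [N _ Nr] : \forall n \near \oo, eball x r (u n) := ux _ (nbhs_eball x r0).
exists (fun n => u (n + N)%N); split.
- move=> n; have [S1u unx] := Su (n + N)%N; split => //.
  suff [] : (S2 `&` eball x r) (u (n + N)%N) by [].
  by rewrite -S12; split => //; apply: Nr; rewrite /= leq_addl.
- exact: cvg_comp (cvg_addnr N) ux.
- exact: cvg_comp (cvg_addnr N) uv.
Qed.

Lemma derivable_cvg_derive1 (V : normedModType R) (f : R -> V) (t : R) :
  derivable f t 1 ->
  h^-1 *: (f (h + t) - f t) @[h --> 0^'] --> (f^`())%classic t.
Proof.
rewrite derive1E /derive /derivable.
suff -> : (fun h : R => h^-1 *: (f (h + t) - f t)) =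
    (fun h => h^-1 *: ((f \o shift t) (h *: (1 : R)) - f t)) by [].
by apply/funext => h; rewrite /= [h *: 1]mulr1.
Qed.

Lemma cross_eq0_trans u v d :
  d != 0 -> cross u d = 0 -> cross v d = 0 -> cross u v = 0.
Proof.
move=> d0 ud vd; apply: contra_neq_eq d0 => uv0.
case: d ud vd => d1 d2; rewrite /cross /= => ud vd; rewrite /cross in uv0.
have h1 : d1 * (u.1 * v.2 - u.2 * v.1) = 0.
  have -> : d1 * (u.1 * v.2 - u.2 * v.1) =
    v.1 * (u.1 * d2 - u.2 * d1) - u.1 * (v.1 * d2 - v.2 * d1) by ring.
  by rewrite ud vd !mulr0 subrr.
have h2 : d2 * (u.1 * v.2 - u.2 * v.1) = 0.
  have -> : d2 * (u.1 * v.2 - u.2 * v.1) =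
    v.2 * (u.1 * d2 - u.2 * d1) - u.2 * (v.1 * d2 - v.2 * d1) by ring.
  by rewrite ud vd !mulr0 subrr.
move/eqP: h1; rewrite mulf_eq0 (negPf uv0) orbF => /eqP ->.
by move/eqP: h2; rewrite mulf_eq0 (negPf uv0) orbF => /eqP ->.
Qed.

Lemma cross_continuous d : continuous (fun u : plane => cross u d).
Proof.
move=> u; have [f1 f2] : y.1 @[y --> u] --> u.1 /\ y.2 @[y --> u] --> u.2.
  by apply/(cvg_fst_snd id); exact: cvg_id.
by apply: cvgB; apply: cvgM => //; exact: cvg_cst.
Qed.

Lemma crossZl (a : R) u v : cross (a *: u) v = a * cross u v.
Proof. by rewrite /cross /= mulrBr !mulrA. Qed.

Lemma crossZr (a : R) u v : cross u (a *: v) = a * cross u v.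
Proof.
change (u.1 * (a * v.2) - u.2 * (a * v.1) = a * (u.1 * v.2 - u.2 * v.1)).
by ring.
Qed.

(* By compactness, [g] is a homeomorphism onto the arc. *)
Lemma arc_param_near (g : R -> plane) (a b t0 e : R) : continuous g ->
  {in `[a, b] &, injective g} -> t0 \in `[a, b] -> 0 < e ->
  exists2 d : R, 0 < d & forall t, t \in `[a, b] ->
    enorm (g t - g t0) < d -> `|t - t0| < e.
Proof.
move=> cg injg t0ab e0.
pose K := [set` `[a, b]] `&` ~` (ball t0 e).
have cK : compact K.
  apply: (subclosed_compact _ (@segment_compact _ a b)) => [|t []//].
  apply: closedI; first exact: interval_closed.
  by apply: open_closedC; exact: ball_open.
have : nbhs (g t0) (~` (g @` K)).
  apply: open_nbhs_nbhs; split.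
    apply: closed_openC; apply: compact_closed; first exact: norm_hausdorff.
    by apply: continuous_compact => //; apply: continuous_subspaceT.
  move=> [t [tab tt0] gt]; apply: tt0.
  by rewrite (injg _ _ _ _ gt) //; exact: ballxx.
move=> /eball_nbhs[d d0 dK]; exists d => // t tab tt0.
rewrite ltNge; apply/negP => et; apply: (dK (g t)) => //.
by exists t => //; split => //; rewrite /ball /= distrC; apply/negP; rewrite -leNgt.
Qed.

(** Points of the arc close to [g t0] have parameters close to [t0], and there the chord is [t - t0]
    times a vector close to [d], the nonzero velocity at [t0]. All tangential directions are thus
    parallel to [d]. *)
Lemma C1_curve_tangential_cross0 (G : set plane) x u v : C1_curve G -> G x ->
  tangential_directions G x u -> tangential_directions G x v -> cross u v = 0.
Proof.
move=> [a [b [g [ab [dg _] injg dg0 ->]]]] [t0 t0ab <-] Gu Gv.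
pose d := (g^`())%classic t0.
have d0 : d != 0 by exact: dg0.
suff cross0 w : tangential_directions (g @` `[a, b]) (g t0) w -> cross w d = 0.
  exact: cross_eq0_trans d0 (cross0 _ Gu) (cross0 _ Gv).
move=> {u v Gu Gv}; apply: (@tangential_homogeneous_eq0 _ _ (cross^~ d)).
- exact: cross_continuous.
- by move=> c u _; exact: crossZl.
move=> e e0.
have cg : continuous g.
  move=> t; have /derivable1_diffP dgt := dg t.
  exact: differentiable_continuous dgt.
have := @cross_continuous d d; rewrite /continuous_at {2}/cross mulrC subrr.
have dgE := derivable_cvg_derive1 (dg t0).
move=> /(cvg_comp _ _ dgE)/cvgr0Pnorm_le crossd.
(* The chord has length at least [|h| * enorm d / 2], which converts an error small relative to
   [|h|] into one small relative to the chord. *)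
have nd0 : 0 < enorm d / 2 by rewrite divr_gt0 ?enorm_gt0.
have : enorm d / 2 < enorm d by rewrite ltr_pdivrMr // ltr_pMr ?enorm_gt0 // ltr1n.
move/(cvgr_gt _ (cvg_enorm dgE)) => enormd.
have [r /= r0 rP] : \forall h \near (0 : R)^',
    `|cross (g (h + t0) - g t0) d| <= e * enorm (g (h + t0) - g t0).
  near=> h.
  have h0 : h != 0 by near: h; exact: nbhs_dnbhs_neq.
  have : `|cross (h^-1 *: (g (h + t0) - g t0)) d| <= e * (enorm d / 2).
    by near: h; apply: crossd; exact: mulr_gt0.
  have : enorm d / 2 <= enorm (h^-1 *: (g (h + t0) - g t0)).
    by apply/ltW; near: h.
  rewrite crossZl enormZ normrM normfV.
  have hn : 0 < `|h| by rewrite normr_gt0.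
  rewrite !ler_pdivlMl // !ler_pdivrMl // => h1 h2.
  apply: le_trans h2 _; rewrite mulrCA; apply: ler_wpM2l => //; exact: ltW.
have [d1 d10 d1P] := arc_param_near cg injg t0ab r0.
exists d1 => // _ [t tab <-] /(d1P _ tab) tt0.
have [->|tt] := eqVneq t t0.
  by rewrite subrr enorm0 mulr0 /cross !mul0r subrr normr0.
have := rP (t - t0); rewrite /ball_ /= sub0r normrN subrK; apply => //.
by rewrite subr_eq0.
Unshelve. all: by end_near. Qed.

(** The part of [wedge] visible in the tangential directions alone. Non-parallelism stands for the
    condition on the angle; being a singularity is a consequence. *)
Definition corner S x := exists u v,
  tangential_directions S x = [set u; v] /\ cross u v != 0.

(** Near [w] the set [S] would coincide with a C^1 arc, whose tangential directions are all
    parallel. Since [w] may differ from [x], this also makes every limit of corners a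
    singularity. *)
Lemma corner_not_smooth_near S x w (d : R) (G : set plane) : 0 < d ->
  C1_curve G -> G = S `&` closure (eball x d) -> S w -> eball x d w ->
  ~ corner S w.
Proof.
move=> d0 CG GE Sw xw [u [v [tuv /eqP]]]; apply.
have [r r0 rP] : exists2 r : R, 0 < r & eball w r `<=` eball x d.
  exists (d - enorm (w - x)); first by rewrite subr_gt0.
  move=> z /=; rewrite /eball /= ltrBrDr; apply: le_lt_trans.
  by rewrite -[z - x](subrKA w); exact: ler_enormD.
have SG : S `&` eball w r = G `&` eball w r.
  rewrite GE -setIA; congr (_ `&` _); apply/seteqP; split=> [z zr|z []//].
  by split => //; apply: subset_closure; exact: rP.
have Gw : G w by rewrite GE; split => //; exact: subset_closure.
apply: (C1_curve_tangential_cross0 CG Gw).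
  by apply: (tangential_local r0 SG); rewrite tuv; left.
by apply: (tangential_local r0 SG); rewrite tuv; right.
Qed.

Lemma corner_wedge S x : S x -> corner S x -> wedge S x.
Proof.
move=> Sx cSx; split.
  split => // -[_ [d d0 [G CG GE]]].
  apply: (corner_not_smooth_near d0 CG GE Sx _ cSx).
  by rewrite /eball /= subrr enorm0.
have [u [v [tuv uv0]]] := cSx; exists u, v; split => //.
  by apply: contraNneq uv0 => ->; rewrite /cross mulrC subrr.
have [u1 _] : tangential_directions S x u by rewrite tuv; left.
have [v1 _] : tangential_directions S x v by rewrite tuv; right.
have := sqr_dot_cross u v; rewrite /angle u1 v1 mulr1 divr1 expr1n => uvE.
have dot1 : dot u v ^+ 2 < 1.
  by rewrite -uvE ltrDl lt_def sqr_ge0 sqrf_eq0 uv0.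
have [h1 h2] : -1 < dot u v /\ dot u v < 1 by split; nra.
by rewrite acos_gt0 ?acos_ltpi ?(ltW h1) ?(ltW h2) ?h1 ?h2.
Qed.

Lemma limit_corner_singularity S x : S x ->
  limit_point [set w | S w /\ corner S w] x -> singularity S x.
Proof.
move=> Sx lx; split => // -[_ [d d0 [G CG GE]]].
have [w [_ [Sw cSw] wx]] := lx _ (nbhs_eball x d0).
exact: corner_not_smooth_near d0 CG GE Sw wx cSw.
Qed.

End tangents.

(** * One-sided derivatives of convex functions *)

Section convex_functions.
Context {R : realType}.
Implicit Types (f : R -> R) (x y z : R).

(** The three-point inequality with denominators cleared: it is linear in the values of [f], hence
    passes to sums and limits. *)
Definition convex3 f := forall x y z, x <= y -> y <= z ->
  f y * (z - x) <= f x * (z - y) + f z * (y - x).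

Definition lip (L : R) f := forall x y, `|f x - f y| <= L * `|x - y|.

(** The one-sided directional derivative, [pr * t] to the right and [pl * t] to the left, in a
    single formula whose continuity is immediate. *)
Definition dir_slope (pl pr t : R) : R := pr * Num.max t 0 + pl * Num.min t 0.

Lemma dir_slope_ge0 pl pr t : 0 <= t -> dir_slope pl pr t = pr * t.
Proof. by move=> t0; rewrite /dir_slope (max_idPl t0) (min_idPr t0) mulr0 addr0. Qed.

Lemma dir_slope_le0 pl pr t : t <= 0 -> dir_slope pl pr t = pl * t.
Proof. by move=> t0; rewrite /dir_slope (max_idPr t0) (min_idPl t0) mulr0 add0r. Qed.

Lemma dir_slopeZ pl pr a t : 0 <= a -> dir_slope pl pr (a * t) = a * dir_slope pl pr t.
Proof.
move=> a0; have [t0|t0] := leP 0 t.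
  by rewrite !dir_slope_ge0 ?mulr_ge0 // mulrCA.
by rewrite !dir_slope_le0 ?mulr_ge0_le0 // ?ltW // mulrCA.
Qed.

Lemma dir_slope_continuous pl pr : continuous (dir_slope pl pr).
Proof.
move=> t; apply: cvgD; apply: cvgM; try exact: cvg_cst.
- by apply: continuous_max; [exact: cvg_id|exact: cvg_cst].
- by apply: continuous_min; [exact: cvg_id|exact: cvg_cst].
Qed.

(* For convex [f], [pl] and [pr] are the left and right derivatives at [x]. *)
Definition slopes f x pl pr := [/\ pl <= pr,
  forall y, f x + dir_slope pl pr (y - x) <= f y &
  forall e, 0 < e -> exists2 d, 0 < d & forall y, `|y - x| < d ->
    f y <= f x + dir_slope pl pr (y - x) + e * `|y - x|].

(** The slope is the infimum of the difference quotients to the right of [x]. By convexity, a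
    quotient within [e] of the infimum at some [z] bounds those at all points between [x] and
    [z]. *)
Lemma convex_right_slope f L x : convex3 f -> lip L f ->
  exists p, [/\ `|p| <= L, forall y, x <= y -> f x + p * (y - x) <= f y &
    forall e, 0 < e -> exists2 d, 0 < d & forall y, x <= y -> y < x + d ->
      f y <= f x + (p + e) * (y - x)].
Proof.
move=> cf lf; pose A := [set (f y - f x) / (y - x) | y in [set y | x < y]].
have Anz : A !=set0.
  by exists ((f (x + 1) - f x) / (x + 1 - x)), (x + 1) => //=; rewrite ltrDl.
have AL z : A z -> `|z| <= L.
  move=> [y /= xy <-]; have y0 : 0 < y - x by rewrite subr_gt0.
  by rewrite normrM normfV ler_pdivrMr ?normr_gt0 ?gt_eqF //; exact: lf.
have Alb : has_lbound A.
  by exists (- L) => z /AL; rewrite ler_norml => /andP[].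
have infA : has_inf A by split.
exists (inf A); split.
- rewrite ler_norml; apply/andP; split.
    by apply: lb_le_inf => // z /AL; rewrite ler_norml => /andP[].
  have [z Az] := Anz; apply: le_trans (ge_inf Alb Az) _.
  exact: le_trans (ler_norm _) (AL _ Az).
- move=> y; rewrite le_eqVlt => /predU1P[->|xy]; first by rewrite subrr mulr0 addr0.
  have y0 : 0 < y - x by rewrite subr_gt0.
  rewrite addrC -lerBrDr -ler_pdivlMr //; apply: ge_inf => //.
  by exists y.
- move=> e e0; have [_ [z /= xz <-] ze] := inf_adherent e0 infA.
  exists (z - x); first by rewrite subr_gt0.
  move=> y; rewrite le_eqVlt => /predU1P[->|xy].
    by rewrite subrr mulr0 addr0.
  rewrite addrC subrK => yz.
  have z0 : 0 < z - x by rewrite subr_gt0.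
  rewrite ltr_pdivrMr // in ze.
  have y0 : 0 < y - x by rewrite subr_gt0.
  have := cf _ _ _ (ltW xy) (ltW yz).
  move: (ler_wpM2l (ltW y0) (ltW ze)) => h1 h2.
  rewrite -(ler_pM2r z0).
  by move: h1 h2; set I := inf A; lra.
Qed.

(** The left slope comes from the right slope of the reflected function at [- x]; convexity across
    [x] puts the two slopes in order. *)
Lemma convex_slopes f L x : convex3 f -> lip L f ->
  exists pl pr, [/\ `|pl| <= L, `|pr| <= L & slopes f x pl pr].
Proof.
move=> cf lf; have [pr [prL prlb prub]] := convex_right_slope x cf lf.
have cg : convex3 (fun y => f (- y)).
  move=> a b c ab bc; have := cf (- c) (- b) (- a).
  by rewrite !lerN2 => /(_ bc ab); lra.
have lg : lip L (fun y => f (- y)).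
  by move=> a b; apply: le_trans (lf _ _) _; rewrite -opprD normrN.
have [p [pL plb pub]] := convex_right_slope (- x) cg lg.
exists (- p), pr; split; [by rewrite normrN|by []|].
have lb1 y : x <= y -> f x + pr * (y - x) <= f y by exact: prlb.
have lb2 y : y <= x -> f x + (- p) * (y - x) <= f y.
  by move=> yx; have := plb (- y); rewrite !opprK lerN2 => /(_ yx); lra.
split.
- apply/ler_addgt0Pr => e e0.
  have e20 : 0 < e / 2 by rewrite divr_gt0.
  have [d1 d10 h1] := prub _ e20; have [d2 d20 h2] := pub _ e20.
  pose t := Num.min d1 d2 / 2.
  have t0 : 0 < t by rewrite divr_gt0 // lt_min d10.
  have tm : t < Num.min d1 d2 by rewrite ltr_pdivrMr // ltr_pMr ?ltr1n // lt_min d10.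
  have td1 : t < d1 by rewrite (lt_le_trans tm) // ge_min lexx.
  have td2 : t < d2 by rewrite (lt_le_trans tm) // ge_min lexx orbT.
  have := h1 (x + t); rewrite lerDl (ltW t0) ltrD2l => /(_ isT td1).
  have := h2 (- x + t); rewrite lerDl (ltW t0) ltrD2l => /(_ isT td2).
  have := cf (x - t) x (x + t); rewrite lerDl gerBl (ltW t0) => /(_ isT isT).
  rewrite !opprD !opprK => h3 h4 h5.
  have {}h3 : 0 <= t * (f (x - t) + f (x + t) - 2 * f x) by lra.
  rewrite pmulr_rge0 // in h3.
  have h6 : 0 <= t * (pr + e + p) by lra.
  by move: h6; rewrite pmulr_rge0 //; lra.
- move=> y; have [xy|/ltW yx] := leP x y.
    by rewrite dir_slope_ge0 ?subr_ge0 //; exact: lb1.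
  by rewrite dir_slope_le0 ?subr_le0 //; exact: lb2.
- move=> e e0; have [d1 d10 h1] := prub _ e0; have [d2 d20 h2] := pub _ e0.
  exists (Num.min d1 d2); first by rewrite lt_min d10.
  move=> y; rewrite lt_min => /andP[yd1 yd2].
  have [xy|/ltW yx] := leP x y.
    rewrite dir_slope_ge0 ?subr_ge0 // ger0_norm ?subr_ge0 //.
    rewrite ger0_norm ?subr_ge0 // in yd1.
    by have := h1 y xy; rewrite addrC -ltrBlDr => /(_ yd1); lra.
  rewrite dir_slope_le0 ?subr_le0 // ler0_norm ?subr_le0 //.
  rewrite ler0_norm ?subr_le0 // in yd2.
  have := h2 (- y); rewrite lerN2 => /(_ yx); rewrite !opprK.
  have -> : - y < - x + d2 by lra.
  by move=> /(_ isT); lra.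
Qed.

Lemma slopes_second_diff f x pl pr c : slopes f x pl pr ->
  (forall t, 0 <= t -> 2 * c * t <= f (x + t) + f (x - t) - 2 * f x) ->
  2 * c <= pr - pl.
Proof.
move=> [_ _ ub] h; apply/ler_addgt0Pr => e e0.
have e20 : 0 < e / 2 by rewrite divr_gt0.
have [d d0 dP] := ub _ e20; pose t := d / 2.
have t0 : 0 < t by rewrite divr_gt0.
have td : t < d by rewrite ltr_pdivrMr // ltr_pMr ?ltr1n.
have := h t (ltW t0); have := dP (x + t); have := dP (x - t).
rewrite [x - t]addrC [x + t]addrC !addrK normrN gtr0_norm // => /(_ td).
rewrite dir_slope_le0 ?oppr_le0 ?(ltW t0) // => h1 /(_ td).
rewrite dir_slope_ge0 ?(ltW t0) // => h2 h3.
have h4 : 0 <= t * (pr - pl + e - 2 * c) by lra.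
by move: h4; rewrite pmulr_rge0 // subr_ge0.
Qed.

Lemma slopes_lt f x y pl pr ql qr : slopes f x pl pr -> slopes f y ql qr ->
  x < y -> pr <= ql.
Proof.
move=> [_ h1 _] [_ h2 _] xy; have := h1 y; have := h2 x.
have y0 : 0 < y - x by rewrite subr_gt0.
rewrite dir_slope_le0 ?subr_le0 ?(ltW xy) // dir_slope_ge0 ?(ltW y0) //.
move=> h3 h4; have h5 : 0 <= (y - x) * (ql - pr) by lra.
by move: h5; rewrite pmulr_rge0 // subr_ge0.
Qed.

(** The intervals between left and right slope at distinct kinks are disjoint, by monotonicity of
    the slopes, and each contains a rational. *)
Lemma countable_kinks f :
  countable [set x | exists pl pr, slopes f x pl pr /\ pl < pr].
Proof.
have /choice[g gP] : forall x, exists r : rat,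
    (exists pl pr, slopes f x pl pr /\ pl < pr) ->
    exists pl pr, slopes f x pl pr /\ pl < ratr r < pr.
  move=> x; have [[pl [pr [sf lt]]]|nex] :=
    pselect (exists pl pr, slopes f x pl pr /\ pl < pr).
    by have [r rP] := rat_in_itvoo lt; exists r => _; exists pl, pr.
  by exists 0.
apply/countable_injP; exists (pickle \o g) => x y /set_mem fx /set_mem fy /=.
move=> /(pcan_inj pickleK) gxy; apply/eqP; rewrite eq_le !leNgt.
have [pl [pr [sx /andP[x1 x2]]]] := gP _ fx.
have [ql [qr [sy /andP[y1 y2]]]] := gP _ fy.
rewrite -gxy in y1 y2.
apply/andP; split; apply/negP => lt.
  by have := slopes_lt sy sx lt; rewrite leNgt (lt_trans x1 y2).
by have := slopes_lt sx sy lt; rewrite leNgt (lt_trans y1 x2).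
Qed.

End convex_functions.

(** * The neighbourhood as a region under a profile *)

Section region.
Context {R : realType}.
Local Notation plane := (R * R)%type.
Variable k : R -> R.

(** The constant [1/4] lets [1 - x^2] dominate [k], so that [height2] changes sign exactly at -1 and
    1, and it keeps the radii of the tangent discs above [1/2]. *)
Definition profile := [/\ k 1 = 0, k (- 1) = 0, lip 4^-1 k & convex3 k].

Definition height2 (x : R) : R := 1 - x ^+ 2 + k x.

Definition region : set plane := [set p | p.2 ^+ 2 <= height2 p.1].

Definition rim : set plane := [set p | p.2 ^+ 2 = height2 p.1].

(** The erosion of [region] by a disc of radius [1/2]: the largest set whose open
    [1/2]-neighbourhood stays in [region]. *)
Definition centers : set plane :=
  [set c | forall v, enorm v < 2^-1 -> region (c + v)].

Hypothesis Hk : profile.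

Lemma profile_lip : lip 4^-1 k. Proof. by case: Hk. Qed.

Lemma height2_lt0 x : 1 < `|x| -> height2 x < 0.
Proof.
case: Hk => k1 kN1 kl _; rewrite /height2.
have [x0|x0] := leP 0 x => hx.
  rewrite ger0_norm // in hx.
  have := le_trans (ler_norm _) (kl x 1); rewrite k1 subr0 ger0_norm; last lra.
  by nra.
rewrite ltr0_norm // in hx.
have := le_trans (ler_norm _) (kl x (- 1)); rewrite kN1 subr0 ler0_norm; last lra.
by nra.
Qed.

(** Besides positivity, the linear growth away from the ends matters: it forces the vertical
    tangents there. *)
Lemma height2_ge x : `|x| <= 1 -> (1 - `|x|) / 2 <= height2 x.
Proof.
case: Hk => k1 kN1 kl _; rewrite /height2.
have [x0|x0] := leP 0 x => hx.
  rewrite ger0_norm // in hx *.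
  have := le_trans (ler_norm _) (kl 1 x); rewrite k1 sub0r ger0_norm; last lra.
  by nra.
rewrite ltr0_norm // in hx *.
have := le_trans (ler_norm _) (kl (- 1) x); rewrite kN1 sub0r ler0_norm; last lra.
by nra.
Qed.

Lemma height2_gt0 x : `|x| < 1 -> 0 < height2 x.
Proof.
move=> x1; apply: lt_le_trans (height2_ge (ltW x1)).
by rewrite divr_gt0 ?subr_gt0.
Qed.

Lemma height2_unit x : `|x| = 1 -> height2 x = 0.
Proof.
case: Hk => k1 kN1 _ _ x1; rewrite /height2 -real_normK ?num_real // x1 expr1n.
rewrite subrr add0r; have [x0|x0] := leP 0 x; move: x1.
  by rewrite ger0_norm // => ->.
by rewrite ltr0_norm // => /(canRL (@opprK _)) ->.
Qed.

Lemma lip_continuous (L : R) (f : R -> R) : lip L f -> continuous f.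
Proof.
move=> lf x; apply/cvgrPdist_lt => e e0.
have L1 : 0 < `|L| + 1 by rewrite ltr_wpDl.
near=> y; apply: le_lt_trans (lf x y) _.
apply: (@le_lt_trans _ _ ((`|L| + 1) * `|x - y|)).
  by rewrite ler_wpM2r // ler_wpDr // ler_norm.
rewrite -ltr_pdivlMl //; near: y.
by apply: (@cvgr_dist_lt _ _ _ (nbhs x)); [exact: cvg_id|rewrite mulr_gt0 ?invr_gt0].
Unshelve. all: by end_near. Qed.

Lemma height2_continuous : continuous height2.
Proof.
move=> x; apply: cvgD; last exact: lip_continuous profile_lip x.
by apply: cvgB; [exact: cvg_cst|apply: exprn_continuous].
Qed.

Lemma gap_continuous : continuous (fun p : plane => height2 p.1 - p.2 ^+ 2).
Proof.
move=> p; have [f1 f2] : q.1 @[q --> p] --> p.1 /\ q.2 @[q --> p] --> p.2.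
  by apply/(cvg_fst_snd id); exact: cvg_id.
apply: cvgB; first exact: cvg_comp f1 (@height2_continuous p.1).
exact: cvg_comp f2 (@exprn_continuous _ 2 p.2).
Qed.

Lemma regionE : region = (fun p : plane => height2 p.1 - p.2 ^+ 2) @^-1` [set x | 0 <= x].
Proof. by apply/seteqP; split => p; rewrite /region /= subr_ge0. Qed.

Lemma closed_region : closed region.
Proof.
rewrite regionE; apply: closed_comp => [p _|]; last exact: closed_ge.
exact: gap_continuous.
Qed.

Lemma region_fst_le1 p : region p -> `|p.1| <= 1.
Proof.
rewrite /region /= => rp; rewrite leNgt; apply/negP => /height2_lt0.
by apply/negP; rewrite -leNgt (le_trans _ rp) // sqr_ge0.
Qed.

Lemma region_snd_le2 p : region p -> `|p.2| <= 2.
Proof.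
move=> rp; have p1 := region_fst_le1 rp.
have : p.2 ^+ 2 <= 2.
  apply: le_trans rp _; rewrite /height2.
  case: Hk => k1 _ kl _.
  have := le_trans (ler_norm _) (kl p.1 1); rewrite k1 subr0.
  have := ler_normB p.1 1; rewrite normr1; have := sqr_ge0 p.1; lra.
rewrite -real_normK ?num_real //; have := normr_ge0 p.2; nra.
Qed.

Lemma subgradient x pl pr y : slopes k x pl pr -> k x + pr * (y - x) <= k y.
Proof.
move=> [plr lb _]; apply: le_trans (lb y); rewrite lerD2l.
have [y0|/ltW y0] := leP 0 (y - x); first by rewrite dir_slope_ge0.
by rewrite dir_slope_le0 // ler_wnM2r.
Qed.

(* Replacing [k] by its tangent line at [p.1] turns [region] into a disc
   centred on the first axis, which lies in [region], contains [p], and has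
   radius at least [1/2]. *)
Lemma region_ball p : region p ->
  exists2 c, centers c & enorm (p - c) <= 2^-1.
Proof.
move=> rp; have p1 := region_fst_le1 rp; case: (Hk) => k1 kN1 kl kc.
have [pl [s [_ sL sl]]] := convex_slopes p.1 kc kl.
(* Completing the square in [y^2 <= 1 - x^2 + k p.1 + s * (x - p.1)] gives the centre [c0] and the
   squared radius [r2]. *)
pose c0 : plane := (s / 2, 0).
pose r2 := 1 + k p.1 - s * p.1 + s ^+ 2 / 4.
have r2_ge : 4^-1 <= r2.
  have h1 : `|s * p.1| <= 4^-1 by rewrite normrM -[4^-1]mulr1 ler_pM.
  have := height2_ge p1; rewrite /height2 => h2.
  have h3 := ler_norm (s * p.1).
  have := sqr_ge0 s; rewrite /r2; have := sqr_ge0 p.1.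
  have := le_trans (ler_norm _) (kl 1 p.1); have := le_trans (ler_norm _) (kl (-1) p.1).
  rewrite k1 kN1 !sub0r; have [x0|x0] := leP 0 p.1.
    rewrite ger0_norm // in p1; rewrite [`|1 - p.1|]ger0_norm; lra.
  rewrite ltr0_norm // in p1; rewrite [`|-1 - p.1|]ler0_norm; lra.
pose r := Num.sqrt r2.
have r_sqr : r ^+ 2 = r2 by rewrite sqr_sqrtr // (le_trans _ r2_ge).
have r0 : 0 <= r by exact: sqrtr_ge0.
have r_ge : 2^-1 <= r by nra.
have rpos : 0 < r by apply: lt_le_trans r_ge.
have disc q : enorm (q - c0) <= r -> region q.
  move=> qr; have : enorm (q - c0) ^+ 2 <= r ^+ 2.
    by rewrite ler_pXn2r // ?nnegrE ?enorm_ge0.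
  rewrite sqr_enorm r_sqr /region /height2 /r2 /=.
  by have := subgradient q.1 sl; lra.
have pc0 : enorm (p - c0) <= r.
  rewrite -(ler_pXn2r (n := 2)) ?nnegrE ?enorm_ge0 // sqr_enorm r_sqr.
  by move: rp; rewrite /region /height2 /r2 /=; lra.
(* The centre [c] divides the segment from [c0] to [p] so that [enorm (p - c) <= l * r = 1/2], while
   [(1 - l) * r + 1/2 = r] keeps the small disc inside the large one. *)
pose l := 2^-1 / r.
have l0 : 0 <= l by rewrite divr_ge0.
have l1 : l <= 1 by rewrite ler_pdivrMr // mul1r.
pose c := c0 + (1 - l) *: (p - c0).
exists c.
  move=> v v2; apply: disc.
  have -> : c + v - c0 = (1 - l) *: (p - c0) + v.
    by rewrite /c addrAC [c0 + _]addrC addrK.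
  apply: le_trans (ler_enormD _ _) _; rewrite enormZ ger0_norm ?subr_ge0 //.
  apply: (@le_trans _ _ ((1 - l) * r + 2^-1)).
    by apply: lerD; [rewrite ler_wpM2l ?subr_ge0|exact: ltW].
  by rewrite mulrBl mul1r /l divfK ?gt_eqF // subrK.
have -> : p - c = l *: (p - c0).
  by rewrite /c opprD addrA -[X in X - _]scale1r -scalerBl opprB [1 + _]addrC subrK.
rewrite enormZ ger0_norm // /l -mulrA ler_piMr // mulrC ler_pdivrMr //.
by rewrite mul1r.
Qed.

Lemma eball_closure (c p : plane) (r : R) : 0 < r -> enorm (p - c) <= r ->
  closure (eball c r) p.
Proof.
move=> r0 pc B /eball_nbhs[e e0 eB]; pose s := e / (e + r).
have er0 : 0 < e + r by exact: addr_gt0.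
have s0 : 0 < s by exact: divr_gt0.
have s1 : s < 1 by rewrite ltr_pdivrMr // mul1r ltrDl.
exists (p + s *: (c - p)); split.
  rewrite /eball /=.
  have -> : p + s *: (c - p) - c = (1 - s) *: (p - c).
    by rewrite scalerBl scale1r addrAC -[c - p]opprB scalerN.
  rewrite enormZ gtr0_norm ?subr_gt0 //.
  apply: (@le_lt_trans _ _ ((1 - s) * r)).
    by rewrite ler_wpM2l // subr_ge0 ltW.
  by rewrite gtr_pMl // ltrBlDr ltrDl.
apply: eB; rewrite /eball /= addrAC subrr add0r enormZ gtr0_norm // enorm_distC.
apply: (@le_lt_trans _ _ (s * r)); first by rewrite ler_pM2l.
by rewrite /s mulrAC ltr_pdivrMr // ltr_pM2l // ltrDr.
Qed.

Lemma closed_eps_nbhd_centers : closed_eps_nbhd 2^-1 centers = region.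
Proof.
apply/seteqP; split.
  rewrite [X in _ `<=` X](closure_id region).1; last exact: closed_region.
  apply: closureS => p [c cc]; rewrite /eball /= => pc.
  by have := cc _ pc; rewrite addrC subrK.
move=> p /region_ball[c cc pc].
have : closure (eball c 2^-1) p by apply: eball_closure.
by apply: closureS => q qc; exists c.
Qed.

Lemma centers_nonempty : centers !=set0.
Proof.
have [c cc _] : exists2 c, centers c & enorm ((0, 0) - c) <= 2^-1.
  apply: region_ball; rewrite /region /= expr0n /=; apply/ltW/height2_gt0.
  by rewrite normr0.
by exists c.
Qed.

Lemma compact_centers : compact centers.
Proof.
apply: (@subclosed_compact plane _ (`[(-1 : R), 1]%classic `*` `[(-2 : R), 2]%classic)).
- have -> : centers = \bigcap_(v in [set v | enorm v < 2^-1])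
      ((fun c => c + v) @^-1` region).
    by apply/seteqP; split => c cP v; exact: cP.
  apply: closed_bigI => v _; apply: closed_comp; last exact: closed_region.
  by move=> c _; apply: cvgD; [exact: cvg_id|exact: cvg_cst].
- by apply: compact_setX; exact: segment_compact.
- move=> c /(_ 0); rewrite enorm0 addr0 invr_gt0 => /(_ (ltr0Sn _ _)) rc.
  by split; rewrite /= in_itv /= -ler_norml;
    [exact: region_fst_le1|exact: region_snd_le2].
Qed.

Lemma boundary_region : boundary region = rim.
Proof.
rewrite /boundary -(closure_id region).1; last exact: closed_region.
apply/seteqP; split.
  move=> p [rp nip]; apply/eqP; rewrite eq_le rp leNgt; apply/negP => plt; apply: nip.
  have := @gap_continuous p; move=> /cvgr_gt/(_ 0); rewrite subr_gt0 => /(_ plt).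
  by apply: filterS => q; rewrite subr_gt0 => /ltW.
move=> p pS; split; first by rewrite /region /= pS.
move=> /eball_nbhs[e e0 eU].
(* A vertical move away from the first axis increases [p.2 ^+ 2] and leaves the region. *)
pose s := if 0 <= p.2 then e / 2 else - (e / 2).
have sE : `|s| = e / 2.
  have e20 : 0 <= e / 2 by rewrite divr_ge0 // ltW.
  by rewrite /s; case: ifP => _; rewrite ?normrN ger0_norm.
have /eU : eball p e (p.1, p.2 + s).
  rewrite /eball /=; apply: le_lt_trans (enorm_leD _) _.
  by rewrite /= subrr normr0 add0r addrAC subrr add0r sE ltr_pdivrMr // ltr_pMr // ltr1n.
rewrite /region /= -pS sqrrD leNgt => /negP; apply.
have : 0 <= s * p.2.
  rewrite /s; case: ifP => [p0|/negbT]; first by rewrite mulr_ge0 // divr_ge0 // ltW.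
  by rewrite -ltNge => p0; rewrite mulr_le0 // ?oppr_le0 ?divr_ge0 // ltW.
have : 0 < s ^+ 2 by rewrite -real_normK ?num_real // sE exprn_gt0 // divr_gt0.
by rewrite mulr2n [p.2 * s]mulrC; lra.
Qed.

End region.

(** * Singularities of the boundary *)

Section rim_tangents.
Context {R : realType}.
Local Notation plane := (R * R)%type.
Variable k : R -> R.
Hypothesis Hk : profile k.

Definition height (x : R) : R := Num.sqrt (height2 k x).

Lemma height_continuous : continuous height.
Proof.
move=> x; have hx : height2 k y @[y --> x] --> height2 k x by exact: height2_continuous.
exact: cvg_comp hx (@sqrt_continuous R (height2 k x)).
Qed.

Lemma height2_ge0 x : `|x| <= 1 -> 0 <= height2 k x.
Proof.
by move=> x1; apply: le_trans (height2_ge Hk x1); rewrite divr_ge0 ?subr_ge0.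
Qed.

Lemma sqr_height x : `|x| <= 1 -> height x ^+ 2 = height2 k x.
Proof. by move=> x1; rewrite sqr_sqrtr ?height2_ge0. Qed.

Lemma height_gt0 x : `|x| < 1 -> 0 < height x.
Proof. by move=> x1; rewrite sqrtr_gt0 height2_gt0. Qed.

Lemma rim_fst_le1 p : rim k p -> `|p.1| <= 1.
Proof. by move=> pS; apply: (region_fst_le1 Hk); rewrite /region /= pS. Qed.

Lemma rim_graph (s x : R) : s ^+ 2 = 1 -> `|x| <= 1 -> rim k (x, s * height x).
Proof. by move=> s1 x1; rewrite /rim /= exprMn s1 mul1r sqr_height. Qed.

Lemma rim_snd p : rim k p -> exists2 s : R, s ^+ 2 = 1 & p.2 = s * height p.1.
Proof.
rewrite /height => <-; rewrite sqrtr_sqr; exists (if 0 <= p.2 then 1 else -1).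
  by case: ifP; rewrite ?sqrrN expr1n.
case: ifP => [p0|/negbT]; first by rewrite mul1r ger0_norm.
by rewrite -ltNge => p0; rewrite ltr0_norm // mulN1r opprK.
Qed.

Lemma rim_snd_eq0 p : rim k p -> (p.2 == 0) = (`|p.1| == 1).
Proof.
move=> pS; apply/eqP/eqP => [p0|p1]; last first.
  by apply/eqP; rewrite -sqrf_eq0 pS height2_unit.
apply/eqP; rewrite eq_le (rim_fst_le1 pS) leNgt; apply/negP => /(height2_gt0 Hk).
by rewrite -pS p0 expr0n ltxx.
Qed.

(** Subtracting the equations of the rim at [q] and [p], with [u = q - p], gives [2 p.1 u.1 + 2 p.2
    u.2 = k q.1 - k p.1 - |u|^2]. One half of [e] absorbs the error of the one-sided derivative, the
    other half the term [|u|^2]. *)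
Lemma rim_first_order p pl pr (e : R) : rim k p -> slopes k p.1 pl pr -> 0 < e ->
  exists2 d : R, 0 < d & forall q, rim k q -> enorm (q - p) < d ->
    `|2 * p.1 * (q - p).1 + 2 * p.2 * (q - p).2 - dir_slope pl pr (q - p).1|
      <= e * enorm (q - p).
Proof.
move=> pS sl e0; have e20 : 0 < e / 2 by rewrite divr_gt0.
have [_ lb ub] := sl; have [d d0 dP] := ub _ e20.
exists (Num.min d (e / 2)); first by rewrite lt_min d0.
move=> q; rewrite -(subrKC p q); move: (q - p) => u {q} qS.
rewrite [p + u]addrC addrK lt_min => /andP[ud ue].
have := dP (p.1 + u.1); have := lb (p.1 + u.1); rewrite [p.1 + _]addrC addrK.
move=> h1 /(_ (le_lt_trans (ler_fst_enorm _) ud)) h2.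
have := ler_fst_enorm u; have := sqr_enorm u; have := enorm_ge0 u.
move: pS qS h1 h2 ue; rewrite /rim /height2 /= [p.1 + u.1]addrC.
set n := enorm u; set D := dir_slope _ _ _; set a := `|u.1|.
move=> pS qS h1 h2 ne n0 nE an.
have h3 : n * n <= (e / 2) * n by rewrite ler_wpM2r // ltW.
have h4 : e / 2 * a <= e / 2 * n by rewrite ler_pM2l.
have h5 : 0 <= n * n by exact: mulr_ge0.
by rewrite ler_norml; apply/andP; split; lra.
Qed.

Lemma rim_tangential_eq p v pl pr : rim k p -> slopes k p.1 pl pr ->
  tangential_directions (rim k) p v ->
  2 * p.1 * v.1 + 2 * p.2 * v.2 = dir_slope pl pr v.1.
Proof.
move=> pS sl tv; apply/eqP; rewrite -subr_eq0; apply/eqP; move: tv.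
apply: (@tangential_homogeneous_eq0 _ _ _ (fun v : plane =>
  2 * p.1 * v.1 + 2 * p.2 * v.2 - dir_slope pl pr v.1)).
- move=> u; have [f1 f2] : q.1 @[q --> u] --> u.1 /\ q.2 @[q --> u] --> u.2.
    by apply/(cvg_fst_snd id); exact: cvg_id.
  apply: cvgB; last exact: cvg_comp f1 (@dir_slope_continuous _ pl pr u.1).
  by apply: cvgD; (apply: cvgM; [exact: cvg_cst|]).
- move=> a u a0; rewrite -[(a *: u).1]/(a * u.1) -[(a *: u).2]/(a * u.2).
  by rewrite dir_slopeZ //; ring.
- by move=> e; exact: rim_first_order.
Qed.

(** The sign [s] selects the side of approach; [l] solves the linearised equation of the rim with
    first coordinate [s]. *)
Lemma rim_graph_tangential p pl pr (s : R) : rim k p -> `|p.1| < 1 -> s ^+ 2 = 1 ->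
  slopes k p.1 pl pr ->
  let l : plane := (s, (dir_slope pl pr s - 2 * p.1 * s) / (2 * p.2)) in
  tangential_directions (rim k) p ((enorm l)^-1 *: l).
Proof.
move=> pS p1 s1 sl l; have [g g1 pE] := rim_snd pS.
have f0 := height_gt0 p1.
have g0 : g != 0 by rewrite -sqrf_eq0 g1 oner_eq0.
have s0 : s != 0 by rewrite -sqrf_eq0 s1 oner_eq0.
have sn : `|s| = 1.
  by apply/eqP; rewrite -(eqrXn2 (n := 2)) // expr1n real_normK ?num_real // s1.
(* The factor keeps [p.1 + s * t n] inside [[-1, 1]]. *)
pose t n : R := (1 - `|p.1|) * n.+1%:R^-1.
have t0 n : 0 < t n by rewrite mulr_gt0 ?subr_gt0 ?invr_gt0.
have tl : t n @[n --> \oo] --> 0.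
  rewrite -(mulr0 (1 - `|p.1|)); apply: cvgM; first exact: cvg_cst.
  exact: cvg_harmonic.
have t1 n : `|p.1 + s * t n| <= 1.
  apply: le_trans (ler_normD p.1 (s * t n)) _; rewrite normrM sn mul1r gtr0_norm //.
  rewrite -lerBrDl ler_piMr ?subr_ge0 ?(ltW p1) // invf_le1 ?ler1n //.
pose x n := p.1 + s * t n.
have xl : x n @[n --> \oo] --> p.1.
  have : p.1 + s * t n @[n --> \oo] --> p.1 + s * 0.
    by apply: cvgD; [exact: cvg_cst|apply: cvgM => //; exact: cvg_cst].
  by rewrite mulr0 addr0.
pose D n := (height (x n) - height p.1) / t n.
have kl : (k (x n) - k p.1) / t n @[n --> \oo] --> dir_slope pl pr s.
  have [_ lb ub] := sl; apply/cvgrPdist_le => e e0.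
  have [d d0 dP] := ub _ e0; near=> n.
  have := lb (x n); have := dP (x n).
  have -> : x n - p.1 = t n * s by rewrite /x addrC addKr mulrC.
  rewrite dir_slopeZ ?(ltW (t0 n)) // normrM sn mulr1 gtr0_norm //.
  have td : t n < d by near: n; apply: (cvgr_lt _ tl).
  move=> /(_ td) h1 h2; rewrite distrC ler_norml; apply/andP; split.
    apply: (@le_trans _ _ 0); first by rewrite oppr_le0 ltW.
    by rewrite subr_ge0 ler_pdivlMr //; lra.
  by rewrite lerBlDl ler_pdivrMr //; lra.
have Dl : D n @[n --> \oo] --> (dir_slope pl pr s - 2 * p.1 * s) / (2 * height p.1).
  (* The difference of square roots is rationalised, so that only difference quotients of [k] and
     [x^2] remain. *)
  have DE n : D n = ((k (x n) - k p.1) / t n - 2 * p.1 * s - t n) /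
                    (height (x n) + height p.1).
    have hn : height (x n) + height p.1 != 0.
      by rewrite gt_eqF // ltr_wpDl // sqrtr_ge0.
    apply: (mulIf hn); rewrite divfK //.
    rewrite /D mulrAC -subr_sqr (sqr_height (t1 n)) (sqr_height (ltW p1)).
    rewrite /height2 /x sqrrD exprMn s1.
    by field; rewrite gt_eqF.
  have -> : D = fun n => ((k (x n) - k p.1) / t n - 2 * p.1 * s - t n) /
                    (height (x n) + height p.1) by apply/funext.
  have -> : (dir_slope pl pr s - 2 * p.1 * s) / (2 * height p.1) =
      (dir_slope pl pr s - 2 * p.1 * s - 0) / (height p.1 + height p.1).
    by rewrite subr0; congr (_ / _); ring.
  apply: cvgM.
    by apply: cvgB => //; apply: cvgB => //; exact: cvg_cst.
  apply: cvgV; first by rewrite gt_eqF // addr_gt0.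
  apply: cvgD; last exact: cvg_cst.
  exact: cvg_comp xl (@height_continuous p.1).
apply: (@tangential_intro _ _ _ (fun n => (x n, g * height (x n)))
  (fun n => (s, g * D n)) t).
- by move=> n; apply: rim_graph => //; exact: t1.
- exact: t0.
- exact: tl.
- by move=> n; apply: contraNneq s0 => -[->].
- move=> n; rewrite [p in RHS]surjective_pairing pE.
  congr (_, _); first by rewrite /x mulrC.
  change (g * height (x n) = g * height p.1 + t n * (g * D n)).
  by rewrite /D; field; rewrite gt_eqF.
- apply/cvg_fst_snd; split; first exact: cvg_cst.
  rewrite /= pE.
  have -> : (dir_slope pl pr s - 2 * p.1 * s) / (2 * (g * height p.1)) =
    g * ((dir_slope pl pr s - 2 * p.1 * s) / (2 * height p.1)).
    have gV : g^-1 = g by apply: (mulIf g0); rewrite mulVf // -expr2.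
    by rewrite [2 * (g * _)]mulrCA invfM gV mulrCA.
  by apply: cvgM => //; exact: cvg_cst.
- by apply: contraNneq s0 => -[->].
Unshelve. all: by end_near. Qed.

(** As [p.2] is nonzero, the linearised equation determines [v.2] from [v.1], and homogeneity leaves
    one unit direction for each sign of [v.1]. The case [v.1 = 0] would give [v = 0]. *)
Lemma rim_tangential_set p pl pr : rim k p -> `|p.1| < 1 -> slopes k p.1 pl pr ->
  let l (s : R) : plane := (s, (dir_slope pl pr s - 2 * p.1 * s) / (2 * p.2)) in
  tangential_directions (rim k) p =
    [set (enorm (l 1))^-1 *: l 1; (enorm (l (-1)))^-1 *: l (-1)].
Proof.
move=> pS p1 sl l.
have p20 : p.2 != 0 by rewrite rim_snd_eq0 // lt_eqF.
apply/seteqP; split; last first.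
  move=> v [->|->]; apply: rim_graph_tangential => //; first by rewrite expr1n.
  by rewrite sqrrN expr1n.
move=> v tv; have := rim_tangential_eq pS sl tv; have [v1 _] := tv.
have scaled (a s : R) : 0 < a -> v = a *: l s -> v = (enorm (l s))^-1 *: l s.
  move=> a0 vE; rewrite {1}vE; congr (_ *: _).
  move: v1; rewrite vE enormZ gtr0_norm // => al.
  have l0 : enorm (l s) != 0.
    by apply: contra_eq_neq al => ->; rewrite mulr0 eq_sym oner_eq0.
  by apply: (mulIf l0); rewrite mulVf.
move=> vF; have vF2 : v.2 = (dir_slope pl pr v.1 - 2 * p.1 * v.1) / (2 * p.2).
  by rewrite -vF; field.
have [v0|v0|v0] := ltgtP v.1 0.
- right; apply: (scaled (- v.1)); first by rewrite oppr_gt0.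
  rewrite [LHS]surjective_pairing; congr (_, _).
    by change (v.1 = - v.1 * -1); rewrite mulrN1 opprK.
  change (v.2 = - v.1 * ((dir_slope pl pr (-1) - 2 * p.1 * -1) / (2 * p.2))).
  have dE : dir_slope pl pr v.1 = - v.1 * dir_slope pl pr (-1).
    by rewrite -dir_slopeZ ?oppr_ge0 ?(ltW v0) // mulrN1 opprK.
  rewrite vF2 dE.
  by field.
- left; apply: (scaled v.1) => //.
  rewrite [LHS]surjective_pairing; congr (_, _).
    by change (v.1 = v.1 * 1); rewrite mulr1.
  change (v.2 = v.1 * ((dir_slope pl pr 1 - 2 * p.1 * 1) / (2 * p.2))).
  have dE : dir_slope pl pr v.1 = v.1 * dir_slope pl pr 1.
    by rewrite -dir_slopeZ ?(ltW v0) // mulr1.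
  rewrite vF2 dE.
  by field.
- exfalso; move: vF2; rewrite v0 dir_slope_ge0 // !mulr0 subrr mul0r => v20.
  move/eqP: v1; rewrite [v]surjective_pairing v0 v20.
  by rewrite -[(0, 0)]/(0 : plane) enorm0 eq_sym oner_eq0.
Qed.

(** Before normalisation, the cross product of the two directions is [(pr - pl) / (2 * p.2)]. *)
Lemma rim_corner p pl pr : rim k p -> `|p.1| < 1 -> slopes k p.1 pl pr -> pl < pr ->
  corner (rim k) p.
Proof.
move=> pS p1 sl plr; have p20 : p.2 != 0 by rewrite rim_snd_eq0 // lt_eqF.
have := rim_tangential_set pS p1 sl; set l := fun s : R => _ => /= tE.
exists ((enorm (l 1))^-1 *: l 1), ((enorm (l (-1)))^-1 *: l (-1)); split => //.
have lne (s : R) : s != 0 -> (enorm (l s))^-1 != 0.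
  by move=> s0; rewrite invr_eq0 enorm_eq0; apply: contraNneq s0 => -[->].
rewrite crossZl mulf_neq0 ?lne ?oner_eq0 //.
rewrite crossZr mulf_neq0 ?lne ?oppr_eq0 ?oner_eq0 //.
rewrite /cross /l /= (dir_slope_ge0 _ _ ler01) (dir_slope_le0 _ _ (lerN10 R)).
have -> : 1 * ((pl * -1 - 2 * p.1 * -1) / (2 * p.2)) -
    (pr * 1 - 2 * p.1 * 1) / (2 * p.2) * -1 = (pr - pl) / (2 * p.2) by field.
by rewrite mulf_neq0 ?invr_eq0 ?mulf_neq0 ?subr_eq0 ?(gt_eqF plr) // pnatr_eq0.
Qed.

Lemma rim_tangent_line p pl : rim k p -> `|p.1| < 1 -> slopes k p.1 pl pl ->
  exists u, tangential_directions (rim k) p = [set u; - u].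
Proof.
move=> pS p1 sl; have := rim_tangential_set pS p1 sl.
set l := fun s : R => _ => /= tE; exists ((enorm (l 1))^-1 *: l 1); rewrite tE.
have -> : l (-1) = - l 1; last by rewrite enormN scalerN.
rewrite /l (dir_slope_ge0 _ _ ler01) (dir_slope_le0 _ _ (lerN10 R)).
congr (_, _); change ((pl * -1 - 2 * p.1 * -1) / (2 * p.2) =
  - ((pl * 1 - 2 * p.1 * 1) / (2 * p.2))).
by rewrite -[RHS]mulNr; congr (_ / _); ring.
Qed.

(** At an end [p.2 = 0], so the linearised equation gives [2 * |v.1| <= |v.1| / 4] and only vertical
    directions survive. Both occur, along the upper and the lower arc. *)
Lemma rim_end_tangent_line p : rim k p -> `|p.1| = 1 ->
  tangential_directions (rim k) p = [set (0, 1); - (0, 1)].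
Proof.
move=> pS p1; have /eqP p20 : p.2 == 0 by rewrite rim_snd_eq0 // p1.
have [_ _ kl kc] := Hk; apply/seteqP; split.
  move=> v tv; have [v1 _] := tv.
  have [pl [pr [plL prL sl]]] := convex_slopes p.1 kc kl.
  have := rim_tangential_eq pS sl tv; rewrite p20 mulr0 mul0r addr0 => vE.
  have v10 : v.1 = 0.
    apply/eqP; rewrite -normr_eq0 eq_le normr_ge0 andbT.
    have : `|2 * p.1 * v.1| <= 4^-1 * `|v.1|.
      rewrite vE; have [v0|/ltW v0] := leP 0 v.1.
        by rewrite dir_slope_ge0 // normrM ler_wpM2r.
      by rewrite dir_slope_le0 // normrM ler_wpM2r.
    have -> : `|2 * p.1 * v.1| = 2 * `|v.1|.
      by rewrite 2!normrM p1 mulr1 ger0_norm.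
    by move=> h; lra.
  have : v.2 ^+ 2 == 1 ^+ 2.
    by have := sqr_enorm v; rewrite v1 v10 expr0n add0r => ->.
  rewrite eqf_sqr => /orP[]/eqP v2; rewrite [v]surjective_pairing v10 v2;
    [left|right] => //.
  by change ((0, -1) = (- 0, -1) :> plane); rewrite oppr0.
pose t n : R := (n.+2)%:R^-1.
have t0 n : 0 < t n by rewrite invr_gt0.
have t1 n : t n < 1 by rewrite invf_lt1 // ltr1n.
have tl : t n @[n --> \oo] --> 0.
  have h : (harmonic (n + 1)%N : R) @[n --> \oo] --> 0.
    exact: cvg_comp (cvg_addnr 1) (@cvg_harmonic R).
  suff -> : t = (fun n => harmonic (n + 1)%N) by exact: h.
  by apply/funext => n; rewrite addn1.
pose x n := p.1 * (1 - t n).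
have xn n : `|x n| = 1 - t n.
  by rewrite normrM p1 mul1r ger0_norm // subr_ge0 ltW.
have xl : x n @[n --> \oo] --> p.1.
  have : p.1 * (1 - t n) @[n --> \oo] --> p.1 * (1 - 0).
    apply: cvgM; first exact: cvg_cst.
    by apply: cvgB => //; exact: cvg_cst.
  by rewrite subr0 mulr1.
have x1 n : `|x n| < 1 by rewrite xn ltrBlDr ltrDl.
have hl : height (x n) @[n --> \oo] --> 0.
  have : height p.1 = 0 by rewrite /height height2_unit // sqrtr0.
  move=> <-; exact: cvg_comp xl (@height_continuous p.1).
have tangent (g : R) : g ^+ 2 = 1 -> tangential_directions (rim k) p (0, g).
  move=> g1; have g0 : g != 0 by rewrite -sqrf_eq0 g1 oner_eq0.
  have l0 : (0, g) != (0 : plane) by apply: contraNneq g0 => -[->].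
  have n1 : enorm ((0, g) : plane) = 1.
    apply/eqP; rewrite -(eqrXn2 (n := 2)) ?enorm_ge0 //.
    by rewrite sqr_enorm expr0n add0r g1 expr1n.
  rewrite -[(0, g)]scale1r -invr1 -n1.
  (* The scale is the vertical displacement; the horizontal one is negligible since [height2_ge]
     yields [t n / height (x n) <= 2 * height (x n)]. *)
  apply: (@tangential_intro _ _ _ (fun n => (x n, g * height (x n)))
    (fun n => (- p.1 * (t n / height (x n)), g)) (fun n => height (x n))) => //.
  - by move=> n; apply: rim_graph => //; exact: ltW.
  - by move=> n; exact: height_gt0.
  - by move=> n; apply: contraNneq g0 => -[_ ->].
  - move=> n; rewrite [p in RHS]surjective_pairing p20.
    congr (_, _); last first.
      by change (g * height (x n) = 0 + height (x n) * g); rewrite add0r mulrC.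
    change (x n = p.1 + height (x n) * (- p.1 * (t n / height (x n)))).
    by rewrite /x; field; rewrite gt_eqF // height_gt0 //; exact: x1.
  - apply/cvg_fst_snd; split; last exact: cvg_cst.
    rewrite /= -(mulr0 (- p.1)); apply: cvgM; first exact: cvg_cst.
    apply: (@squeeze_cvgr _ _ _ _ (fun=> 0) (fun n => 2 * height (x n))).
    + apply: nearW => n; rewrite divr_ge0 ?(ltW (t0 n)) ?sqrtr_ge0 //=.
      rewrite ler_pdivrMr ?height_gt0 // -mulrA -expr2 (sqr_height (ltW (x1 n))).
      have := height2_ge Hk (ltW (x1 n)); rewrite xn.
      by move=> hn; lra.
    + exact: cvg_cst.
    + by rewrite -(mulr0 2); apply: cvgM => //; exact: cvg_cst.
move=> v [->|->]; first by apply: tangent; rewrite expr1n.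
have -> : - (0, 1) = (0, -1) :> plane.
  by change ((- 0, -1) = (0, -1) :> plane); rewrite oppr0.
by apply: tangent; rewrite sqrrN expr1n.
Unshelve. all: by end_near. Qed.

(* Implied by the convexity of [k x - c * `|x - q|] in [x]: the slope of [k]
   jumps by at least [2 c] at [q]. *)
Definition kink (q c : R) := forall x t, 0 <= t ->
  2 * c * (t - `|x - q|) <= k (x + t) + k (x - t) - 2 * k x.

Hypothesis dense_kinks : forall a b, -1 <= a -> a < b -> b <= 1 ->
  exists q c, [/\ a < q < b, 0 < c & kink q c].

Lemma limit_corner p : rim k p -> limit_point [set w | rim k w /\ corner (rim k) w] p.
Proof.
move=> pS V pV; have [g g1 pE] := rim_snd pS.
have : (x, g * height x) @[x --> p.1] --> p.
  apply/cvg_fst_snd; split; first exact: cvg_id.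
  by rewrite /= pE; apply: cvgM; [exact: cvg_cst|exact: height_continuous].
move=> /(_ _ pV) [d /= d0 dV].
have := rim_fst_le1 pS; rewrite ler_norml => /andP[p1 p2].
(* The interval lies on the side of [p.1] facing the middle of [[-1, 1]], which leaves room even at
   the ends, and it omits [p.1]. *)
have [a [b [a1 ab b1 abd]]] : exists a b, [/\ -1 <= a, a < b, b <= 1 &
    forall q, a < q < b -> `|p.1 - q| < d /\ q != p.1].
  have [x0|x0] := leP p.1 0.
    exists p.1, (Num.min (p.1 + d) 1); split=> //.
    - by rewrite lt_min ltrDl d0 (le_lt_trans x0).
    - by rewrite ge_min lexx orbT.
    - move=> q; rewrite lt_min => /and3P[pq qd _]; split; last by rewrite gt_eqF.
      by rewrite ltr0_norm ?subr_lt0 // opprB ltrBlDl.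
  exists (Num.max (p.1 - d) (-1)), p.1; split=> //.
  - by rewrite le_max lexx orbT.
  - by rewrite gt_max ltrBlDr ltrDl d0 (lt_trans _ x0) // ltrN10.
  - move=> q; rewrite gt_max => /andP[/andP[qd _] qp]; split; last by rewrite lt_eqF.
    by rewrite gtr0_norm ?subr_gt0 // ltrBlDl -ltrBlDr.
have [q [c [abq c0 kq]]] := dense_kinks a1 ab b1.
have q1 : `|q| < 1.
  rewrite ltr_norml; case/andP: abq => aq qb.
  by rewrite (le_lt_trans a1 aq) (lt_le_trans qb b1).
have [qd qp] := abd q abq.
exists (q, g * height q); split; last exact: dV.
  by apply: contraNneq qp => <-.
have qS : rim k (q, g * height q) by apply: rim_graph => //; exact: ltW.
split => //; have [_ _ kl kc] := Hk.
have [pl [pr [_ _ sl]]] := convex_slopes q kc kl.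
apply: (rim_corner qS q1 sl).
rewrite -subr_gt0; apply: (@lt_le_trans _ _ (2 * c)); first by rewrite mulr_gt0.
apply: slopes_second_diff sl _ => t t0.
by have := kq q t t0; rewrite subrr normr0 subr0.
Qed.

Lemma rim_wedge_or_shallow p : rim k p ->
  wedge (rim k) p \/ shallow_singularity (rim k) p.
Proof.
move=> pS; have lp := limit_corner pS.
have shallow u : tangential_directions (rim k) p = [set u; - u] ->
    shallow_singularity (rim k) p.
  move=> tu; split; [exact: limit_corner_singularity|by exists u|].
  move=> V /lp[w [wp [Sw cw] Vw]]; exists w; split => //; exact: corner_wedge.
have := rim_fst_le1 pS; rewrite le_eqVlt => /predU1P[p1|p1].
  by right; apply: shallow; exact: rim_end_tangent_line.
have [_ _ kl kc] := Hk.
have [pl [pr [_ _ sl]]] := convex_slopes p.1 kc kl.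
have [lt|le] := ltP pl pr.
  by left; apply: corner_wedge => //; exact: rim_corner sl lt.
right; have plr : pl = pr by apply/eqP; rewrite eq_le le andbT; case: sl.
by rewrite -plr in sl; have [u] := rim_tangent_line pS p1 sl; exact: shallow.
Qed.

End rim_tangents.

(** * Mean values with countable exceptional sets *)

Section countable_mean_value.
Context {R : realType}.

Lemma not_countable_itvoo (a b : R) (B : set R) : a < b -> countable B ->
  exists y, a < y < b /\ ~ B y.
Proof.
move=> ab cB; apply: contrapT => nex.
have sub : `]a, b[%classic `<=` B.
  move=> y; rewrite /= in_itv /= => yab; apply: contrapT => nBy.
  by apply: nex; exists y.
have /countable_lebesgue_measure0 : countable `]a, b[%classic.
  exact: sub_countable (subset_card_le sub) cB.
rewrite lebesgue_measure_itv /= lte_fin ab -EFinB => -[] /eqP.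
by rewrite subr_eq0 gt_eqF.
Qed.

(* The point [s] is the last one where [g t - m * t] takes a value chosen
   outside the image of [B]. *)
Lemma countable_mean_value (g : R -> R) (a b m : R) (B : set R) :
  continuous g -> a < b -> countable B -> m * (b - a) < g b - g a ->
  exists s, [/\ a < s, s < b, ~ B s & forall d,
    h^-1 *: (g (h + s) - g s) @[h --> 0^'] --> d -> m <= d].
Proof.
move=> cg ab cB gab; pose f t := g t - m * t.
have cf : continuous f.
  move=> t; apply: cvgB; first exact: cg.
  by apply: cvgM; [exact: cvg_cst|exact: cvg_id].
have fab : f a < f b by rewrite /f; lra.
have cfB : countable (f @` B) by exact: sub_countable (card_image_le _ _) cB.
have [y [/andP[ay yb] nBy]] := not_countable_itvoo fab cfB.
pose A := [set z | a <= z <= b /\ f z <= y].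
have Aa : A a by split; rewrite ?lexx ?(ltW ab) // ltW.
have supA : has_sup A.
  by split; [exists a|exists b => z [/andP[]]].
pose s := sup A.
have as_ : a <= s by apply: ub_le_sup => //; case: supA.
have sb_ : s <= b by apply: ge_sup; [exists a|move=> z [/andP[]]].
have fs : f s = y.
  apply/eqP; rewrite eq_le; apply/andP; split; rewrite leNgt; apply/negP.
    move=> ys; have := cvgr_gt _ (cf s) _ ys.
    move=> [d /= d0 dP]; have [z [zab zy] zs] := sup_adherent d0 supA.
    have zs' : z <= s by apply: ub_le_sup; [case: supA|].
    suff : y < f z by rewrite ltNge zy.
    by apply: dP; rewrite /= ger0_norm ?subr_ge0 // ltrBlDr addrC -ltrBlDr.
  move=> sy; have := cvgr_lt _ (cf s) _ sy.
  move=> [d /= d0 dP].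
  have sb : s < b.
    rewrite lt_neqAle sb_ andbT; apply: contraTneq sy => ->.
    by rewrite -leNgt ltW.
  pose z := Num.min b (s + d / 2).
  have sz : s < z by rewrite lt_min sb ltrDl divr_gt0.
  have zb : z <= b by rewrite ge_min lexx.
  have zd : z < s + d.
    by rewrite gt_min ltrD2l ltr_pdivrMr // ltr_pMr ?ltr1n ?orbT.
  suff : z <= s by rewrite leNgt sz.
  apply: ub_le_sup; first by case: supA.
  split; first by rewrite zb (le_trans as_ (ltW sz)).
  apply/ltW/dP; rewrite /= distrC gtr0_norm ?subr_gt0 //.
  by rewrite ltrBlDl.
have s_a : a < s.
  rewrite lt_neqAle as_ andbT; apply/negP => /eqP as_E.
  by move: ay; rewrite as_E fs ltxx.
have s_b : s < b.
  rewrite lt_neqAle sb_ andbT; apply/negP => /eqP sbE.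
  by move: yb; rewrite -sbE fs ltxx.
(* Since [f] stays above [y = f s] to the right of [s], the right difference quotients of [g] at [s]
   are at least [m]. *)
have after z : s < z -> z <= b -> y <= f z.
  move=> sz zb; rewrite leNgt; apply/negP => zy.
  suff : z <= s by rewrite leNgt sz.
  apply: ub_le_sup; first by case: supA.
  by split; [rewrite zb (le_trans as_ (ltW sz))|exact: ltW].
exists s; split => //; first by move=> Bs; apply: nBy; exists s.
move=> d /cvg_dnbhs_at_right gd; rewrite -(cvg_lim _ gd) //.
apply: limr_ge; first exact: cvgP gd.
near=> h.
have h0 : 0 < h by near: h; exact: nbhs_right_gt.
rewrite ler_pdivlMl // mulrC.
have : y <= f (h + s).
  apply: after; first by rewrite ltrDr.
  rewrite -lerBrDr; near: h; apply: nbhs_right_le.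
  by rewrite subr_gt0.
by rewrite -fs /f; lra.
Unshelve. all: by end_near. Qed.

(** Otherwise the mean value inequality for [h] or [- h] would give a point [s] outside [B],
    strictly between 0 and [t], with a derivative of size at least [M * |t|], against the bound
    [M * |s|]. *)
Lemma countable_derivative_quadratic (h : R -> R) (B : set R) (M r : R) :
  continuous h -> countable B -> h 0 = 0 -> 0 < M ->
  (forall t, 0 < `|t| < r -> ~ B t ->
     derivable h t 1 /\ `|(h^`())%classic t| <= M * `|t|) ->
  forall t, `|t| < r -> `|h t| <= M * t ^+ 2.
Proof.
move=> ch cB h0 M0 dh t tr.
have main (g : R -> R) a b : continuous g -> a < b ->
    (forall s, a < s -> s < b -> 0 < `|s| < `|t|) ->
    (forall s, derivable h s 1 -> exists d,
      u^-1 *: (g (u + s) - g s) @[u --> 0^'] --> d /\ d <= `|(h^`())%classic s|) ->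
    g b - g a <= M * `|t| * (b - a).
  move=> cg ab ins dg; rewrite leNgt; apply/negP => gab.
  have [s [s1 s2 nBs sd]] := countable_mean_value cg ab cB gab.
  have /andP[s0 st] := ins s s1 s2.
  have [|dhs hM] := dh s _ nBs; first by rewrite s0 (lt_trans st).
  have [d [gd dle]] := dg s dhs.
  have := le_trans (le_trans (sd d gd) dle) hM.
  by rewrite ler_pM2l // leNgt st.
have hpos s : derivable h s 1 -> exists d,
    u^-1 *: (h (u + s) - h s) @[u --> 0^'] --> d /\ d <= `|(h^`())%classic s|.
  move=> dhs; exists ((h^`())%classic s); split; last exact: ler_norm.
  exact: derivable_cvg_derive1.
have hneg s : derivable h s 1 -> exists d,
    u^-1 *: (- h (u + s) - - h s) @[u --> 0^'] --> d /\ d <= `|(h^`())%classic s|.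
  move=> dhs; exists (- (h^`())%classic s); split.
    rewrite (_ : (fun u => _) = (fun u : R => - (u^-1 *: (h (u + s) - h s)))).
      by apply: cvgN; exact: derivable_cvg_derive1.
    by apply/funext => u; rewrite -opprD scalerN.
  by rewrite -normrN ler_norm.
have cNh : continuous (fun t => - h t) by move=> z; apply: cvgN; exact: ch.
have tt : t ^+ 2 = `|t| * `|t| by rewrite -expr2 real_normK ?num_real.
have [t0|t0|->] := ltgtP t 0; last by rewrite h0 normr0 expr0n mulr0.
- have ins s : t < s -> s < 0 -> 0 < `|s| < `|t|.
    by move=> ts s0; rewrite !ltr0_norm ?oppr_gt0 ?s0 ?ltrN2.
  have := main _ _ _ ch t0 ins hpos; have := main _ _ _ cNh t0 ins hneg.
  rewrite h0 tt ltr0_norm // => h1 h2.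
  by rewrite ler_norml; apply/andP; split; lra.
- have ins s : 0 < s -> s < t -> 0 < `|s| < `|t|.
    by move=> ts s0; rewrite !gtr0_norm ?ts.
  have := main _ _ _ ch t0 ins hpos; have := main _ _ _ cNh t0 ins hneg.
  rewrite h0 tt gtr0_norm // => h1 h2.
  by rewrite ler_norml; apply/andP; split; lra.
Qed.

End countable_mean_value.

(** * Orthonormal frames and differentiability of graphs with tangent lines *)

Section frames.
Context {R : realType}.
Local Notation plane := (R * R)%type.
Implicit Types (S : set plane) (u v w x y nu : plane).

Definition frame (e1 e2 : plane) := [/\ enorm e1 = 1, enorm e2 = 1 & dot e1 e2 = 0].

Lemma dotDr u v w : dot u (v + w) = dot u v + dot u w.
Proof. by rewrite /dot /=; ring. Qed.

Lemma dotZr (a : R) u v : dot u (a *: v) = a * dot u v.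
Proof.
change (u.1 * (a * v.1) + u.2 * (a * v.2) = a * (u.1 * v.1 + u.2 * v.2)).
by ring.
Qed.

Lemma dotC u v : dot u v = dot v u.
Proof. by rewrite /dot mulrC [u.2 * _]mulrC. Qed.

Lemma dot_unit (e1 : plane) : enorm e1 = 1 -> dot e1 e1 = 1.
Proof. by move=> n1; rewrite /dot -!expr2 -sqr_enorm n1 expr1n. Qed.

Lemma frame_eq0 (e1 e2 : plane) nu : frame e1 e2 ->
  dot nu e1 = 0 -> dot nu e2 = 0 -> nu = 0.
Proof.
move=> [n1 n2 d12] h1 h2.
have : dot e1 e2 ^+ 2 + cross e1 e2 ^+ 2 = 1.
  by rewrite sqr_dot_cross n1 n2 mulr1 expr1n.
rewrite d12 expr0n add0r => c2.
have c0 : cross e1 e2 != 0 by rewrite -sqrf_eq0 c2 oner_eq0.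
have e1nu : nu.1 * cross e1 e2 = 0.
  have -> : nu.1 * cross e1 e2 = e2.2 * dot nu e1 - e1.2 * dot nu e2.
    by rewrite /cross /dot; ring.
  by rewrite h1 h2 !mulr0 subrr.
have e2nu : nu.2 * cross e1 e2 = 0.
  have -> : nu.2 * cross e1 e2 = e1.1 * dot nu e2 - e2.1 * dot nu e1.
    by rewrite /cross /dot; ring.
  by rewrite h1 h2 !mulr0 subrr.
move/eqP: e1nu; move/eqP: e2nu; rewrite !mulf_eq0 (negPf c0) !orbF => /eqP n2E /eqP n1E.
by rewrite [nu]surjective_pairing n1E n2E.
Qed.

(* If [S] has a tangent line at a point of the graph, that line cannot be
   parallel to [e2], because [h] is Lipschitz; its slope is the derivative. *)
Lemma graph_derivable S x (e1 e2 : plane) (h : R -> R) (L r t : R) nu :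
  frame e1 e2 -> lip L h ->
  let Q := fun t : R => x + t *: e1 + h t *: e2 in
  (forall s, enorm (Q s - x) < r -> S (Q s)) -> enorm (Q t - x) < r -> nu != 0 ->
  (forall e : R, 0 < e -> exists2 d : R, 0 < d & forall y, S y ->
     enorm (y - Q t) < d -> `|dot nu (y - Q t)| <= e * enorm (y - Q t)) ->
  derivable h t 1.
Proof.
move=> fr lh Q SQ Qr nu0 tan; have [n1 n2 _] := fr.
pose K := 1 + `|L|.
have K0 : 0 < K by rewrite ltr_pwDl.
have QE s : Q s - Q t = (s - t) *: e1 + (h s - h t) *: e2.
  rewrite /Q !scalerBl !opprD [LHS]addrACA; congr (_ + _).
  by rewrite addrACA subrr add0r.
have Qn s : enorm (Q s - Q t) <= K * `|s - t|.
  rewrite QE; apply: le_trans (ler_enormD _ _) _.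
  rewrite !enormZ n1 n2 !mulr1 mulrDl mul1r lerD2l.
  by apply: le_trans (lh _ _) _; rewrite ler_wpM2r // ler_norm.
pose rho := r - enorm (Q t - x).
have rho0 : 0 < rho by rewrite subr_gt0.
have small (e : R) : 0 < e -> exists2 d : R, 0 < d & forall s, `|s - t| < d ->
    `|dot nu e1 * (s - t) + dot nu e2 * (h s - h t)| <= e * `|s - t|.
  move=> e0; have [d d0 dP] := tan (e / K) (divr_gt0 e0 K0).
  exists (Num.min d rho / K); first by rewrite divr_gt0 // lt_min d0.
  move=> s; rewrite ltr_pdivlMr // mulrC => st.
  have := le_lt_trans (Qn s) st; rewrite lt_min => /andP[sd sr].
  have SQs : S (Q s).
    apply: SQ; rewrite -[Q s - x](subrKA (Q t)).
    by apply: le_lt_trans (ler_enormD _ _) _; rewrite -ltrBrDr.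
  have := dP _ SQs sd; rewrite {1}QE dotDr !dotZr mulrC [_ * dot nu e2]mulrC.
  move=> h1; apply: le_trans h1 _.
  by rewrite -mulrA ler_pM2l // ler_pdivrMl.
(* If [dot nu e2] vanished, [small] would force [dot nu e1 = 0] as well, and [nu] would be
   orthogonal to both frame vectors. *)
have b0 : dot nu e2 != 0.
  apply: contra_neq nu0 => b0; apply: (frame_eq0 fr) => //.
  apply/eqP; rewrite -normr_eq0 eq_le normr_ge0 andbT; apply/ler_addgt0Pr => e e0.
  rewrite add0r; have [d d0 dP] := small e e0.
  have d2 : 0 < d / 2 by rewrite divr_gt0.
  have := dP (t + d / 2); rewrite [t + _ - _]addrC addKr gtr0_norm //.
  rewrite ltr_pdivrMr // ltr_pMr // ltr1n => /(_ isT).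
  by rewrite b0 mul0r addr0 normrM [`|d / 2|]gtr0_norm // ler_pM2r.
apply/cvg_ex; exists (- (dot nu e1 / dot nu e2)).
apply/cvgrPdist_le => e e0.
have b1 : 0 < `|dot nu e2| by rewrite normr_gt0.
have [d d0 dP] := small _ (mulr_gt0 e0 b1).
near=> u; rewrite /= [u *: 1]mulr1.
have u0 : u != 0 by near: u; exact: nbhs_dnbhs_neq.
have ud : `|u| < d.
  near: u; apply: (@dnbhs0_lt R).
  exact: d0.
have := dP (u + t); rewrite addrK => /(_ ud) h1.
have un : 0 < `|u| by rewrite normr_gt0.
rewrite -(ler_pM2r (mulr_gt0 b1 un)).
have -> : e * (`|dot nu e2| * `|u|) = e * `|dot nu e2| * `|u| by rewrite mulrA.
apply: le_trans h1; rewrite -2!normrM -normrN.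
rewrite le_eqVlt; apply/orP; left; apply/eqP; congr (`| _ |).
change (- ((- (dot nu e1 / dot nu e2) - u^-1 * (h (u + t) - h t)) *
  (dot nu e2 * u)) = dot nu e1 * u + dot nu e2 * (h (u + t) - h t)).
by field; rewrite u0.
Unshelve. all: by end_near. Qed.

End frames.

(** * Absence of curvature *)

Section rim_curvature.
Context {R : realType}.
Local Notation plane := (R * R)%type.
Variable k : R -> R.
Hypothesis Hk : profile k.

Lemma dir_slope_diag (s t : R) : dir_slope s s t = s * t.
Proof.
by have [t0|/ltW t0] := leP 0 t; [rewrite dir_slope_ge0|rewrite dir_slope_le0].
Qed.

Lemma lip_of_lipschitz (h : R -> R) : lipschitz h -> exists2 L, 0 < L & lip L h.
Proof.
move=> /pinfty_ex_gt0[L L0 hL]; exists L => // x y.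
by have := hL (x, y); exact.
Qed.

(** Away from kinks the rim has the normal vector [(2 x - k' x, 2 y)], the gradient of its equation,
    and hence a tangent line in every frame. *)
Lemma rim_graph_derivable p q (e1 e2 : plane) (h : R -> R) (L r t : R) :
  frame e1 e2 -> lip L h -> q = p + t *: e1 + h t *: e2 ->
  rim k `&` eball p r =
    range (fun t : R => p + t *: e1 + h t *: e2) `&` eball p r ->
  enorm (q - p) < r -> `|q.1| < 1 ->
  (~ exists pl pr, slopes k q.1 pl pr /\ pl < pr) -> derivable h t 1.
Proof.
move=> fr lh qE rimE qr q1 nkink.
have Q_rim s : enorm (p + s *: e1 + h s *: e2 - p) < r ->
    rim k (p + s *: e1 + h s *: e2).
  move=> sr; suff [] : (rim k `&` eball p r) (p + s *: e1 + h s *: e2) by [].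
  by rewrite rimE; split => //; exists s.
have qS : rim k q by rewrite qE; apply: Q_rim; rewrite -qE.
have [_ _ kl kc] := Hk; have [pl [pr [_ _ sl]]] := convex_slopes q.1 kc kl.
have plr : pl = pr.
  apply/eqP; rewrite eq_le; have [-> _ _] := sl => /=.
  by rewrite leNgt; apply/negP => lt; apply: nkink; exists pl, pr.
rewrite plr in sl.
pose nu : plane := (2 * q.1 - pr, 2 * q.2).
apply: (@graph_derivable _ (rim k) p e1 e2 h L r t nu) => //=.
- by rewrite -qE.
- have q20 : q.2 != 0 by rewrite (rim_snd_eq0 Hk) // lt_eqF.
  apply: contraNneq q20 => -[_ /eqP].
  by rewrite mulf_eq0 pnatr_eq0.
move=> e e0; have [d d0 dP] := rim_first_order qS sl e0; rewrite -qE.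
exists d => // y yS yd; have := dP y yS yd; rewrite dir_slope_diag.
suff -> : dot nu (y - q) =
    2 * q.1 * (y - q).1 + 2 * q.2 * (y - q).2 - pr * (y - q).1 by [].
by rewrite /dot /nu /=; ring.
Qed.

Lemma curvature_defined_flat p : rim k p -> `|p.1| < 1 -> curvature_defined (rim k) p ->
  exists (e : plane) (M d : R), [/\ enorm e = 1, 0 < M, 0 < d &
    forall q, rim k q -> enorm (q - p) < d ->
      `|dot e (q - p)| <= M * enorm (q - p) ^+ 2].
Proof.
move=> pS p1 [e1 [e2 [h [fr [r r0 rimE] /lip_of_lipschitz[L L0 lh]]]]].
move=> [h0 _ dh0] [l hl].
have [n1 n2 d12] := fr.
pose Q t : plane := p + t *: e1 + h t *: e2.
have QpE t : Q t - p = t *: e1 + h t *: e2.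
  by rewrite /Q addrC !addrA addNr add0r.
have Qn t : enorm (Q t - p) <= (1 + L) * `|t|.
  rewrite QpE; apply: le_trans (ler_enormD _ _) _.
  rewrite !enormZ n1 n2 !mulr1 mulrDl mul1r lerD2l.
  by have := lh t 0; rewrite h0 !subr0.
have tE t : t = dot e1 (Q t - p).
  by rewrite QpE dotDr !dotZr d12 (dot_unit n1) mulr0 addr0 mulr1.
have hE t : h t = dot e2 (Q t - p).
  by rewrite QpE dotDr !dotZr dotC d12 (dot_unit n2) mulr0 add0r mulr1.
have p20 : p.2 != 0 by rewrite (rim_snd_eq0 Hk) // lt_eqF.
have [eta eta0 etaP] : exists2 eta : R, 0 < eta & forall t, 0 < `|t| < eta ->
    derivable h t 1 -> `|(h^`())%classic t| <= (`|l| + 1) * `|t|.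
  have [d /= d0 dP] : \forall t \near 0^', derivable h t 1 ->
      `|(h^`())%classic t| <= (`|l| + 1) * `|t|.
    have : \forall t \near within [set t | derivable h t 1] (0 : R)^',
        `|((h^`())%classic t - (h^`())%classic 0) / t| <= `|l| + 1.
      apply: (cvgr_norm_le _ hl); by rewrite ltrDl.
    rewrite near_withinE => H; near=> t => dt.
    have t0 : t != 0 by near: t; exact: nbhs_dnbhs_neq.
    have tn : 0 < `|t| by rewrite normr_gt0.
    rewrite -ler_pdivrMr // -normfV -normrM.
    suff : `|((h^`())%classic t - (h^`())%classic 0) / t| <= `|l| + 1.
      by rewrite dh0 subr0.
    by move: dt; near: t.
  exists d => // t /andP[t0 td]; apply: dP.
    by rewrite /ball_ /= sub0r normrN.
  by rewrite -normr_gt0.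
(* Points of the rim closer to [p] than [m] avoid the two ends and lie on the same arc, upper or
   lower, as [p]. *)
pose m := Num.min (1 - `|p.1|) `|p.2|.
have m0 : 0 < m by rewrite lt_min subr_gt0 p1 normr_gt0.
pose rho := Num.min eta (Num.min r m / (1 + L)).
have L1 : 0 < 1 + L by rewrite addr_gt0.
have rho0 : 0 < rho.
  by rewrite lt_min eta0 divr_gt0 // lt_min r0.
have Qrho t : `|t| < rho -> [/\ enorm (Q t - p) < r, `|(Q t).1| < 1,
    `|(Q t).2 - p.2| < `|p.2| & rim k (Q t)].
  rewrite lt_min => /andP[_]; rewrite ltr_pdivlMr // mulrC => /(le_lt_trans (Qn t)).
  rewrite !lt_min => /and3P[tr t1 t2]; split => //.
  - rewrite -[(Q t).1](subrK p.1); apply: le_lt_trans (ler_normD _ _) _.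
    rewrite -ltrBrDr; apply: le_lt_trans t1; exact: ler_fst_enorm (Q t - p).
  - apply: le_lt_trans t2; exact: ler_snd_enorm (Q t - p).
  - suff [] : (rim k `&` eball p r) (Q t) by [].
    by rewrite rimE; split => //; exists t.
pose N := [set x | exists pl pr, slopes k x pl pr /\ pl < pr].
(* Parameters of points above kinks. On one arc the abscissa determines the point, and [Q t]
   determines [t], so countability passes from the kinks of [k] to [B]. *)
pose B := [set t | `|t| < rho /\ N (Q t).1].
have cB : countable B.
  have /countable_injP[f injf] := countable_kinks k.
  apply/countable_injP; exists (fun t => f (Q t).1) => s t.
  move=> /set_mem[sr Ns] /set_mem[tr Nt] /(injf _ _ (mem_set Ns) (mem_set Nt)) Q1.
  have [_ _ s2 sS] := Qrho s sr; have [_ _ t2 tS] := Qrho t tr.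
  suff QE : Q s = Q t by rewrite (tE s) (tE t) QE.
  have : (Q s).2 ^+ 2 == (Q t).2 ^+ 2 by rewrite sS tS Q1.
  rewrite eqf_sqr => /orP[] /eqP Q2.
    by rewrite [LHS]surjective_pairing [RHS]surjective_pairing Q1 Q2.
  exfalso; rewrite Q2 in s2; move: s2 t2; rewrite !ltr_norml => /andP[].
  by have [p0|p0] := leP 0 p.2; [rewrite ger0_norm|rewrite ltr0_norm] => //;
    move=> ? ? /andP[]; lra.
have ch : continuous h by exact: lip_continuous lh.
have M0 : 0 < `|l| + 1 by rewrite ltr_wpDl.
have quad := countable_derivative_quadratic ch cB h0 M0 (r := rho).
have {}quad t : `|t| < rho -> `|h t| <= (`|l| + 1) * t ^+ 2.
  apply: quad => {}t /andP[t0 tr] nB.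
  have [Qr Q1 _ QS] := Qrho t tr.
  have dt : derivable h t 1.
    apply: (rim_graph_derivable fr lh (erefl (Q t)) rimE Qr Q1) => Nt.
    by apply: nB; split.
  split => //; apply: etaP => //; rewrite t0 (lt_le_trans tr) //.
  by rewrite ge_min lexx.
exists e2, (`|l| + 1), (Num.min rho r); split => //.
  by rewrite lt_min rho0.
move=> q qS; rewrite lt_min => /andP[qrho qr].
have [t _ tq] : range Q q.
  suff [] : (range Q `&` eball p r) q by [].
  by rewrite -rimE; split.
have tn : `|t| <= enorm (q - p).
  by rewrite (tE t) tq; apply: le_trans (normr_dot_le _ _) _; rewrite n1 mul1r.
have := quad t (le_lt_trans tn qrho); rewrite {1}(hE t) tq => h1.
apply: le_trans h1 _; rewrite ler_pM2l // -real_normK ?num_real //.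
by rewrite ler_pXn2r // nnegrE enorm_ge0.
Unshelve. all: by end_near. Qed.

(** Along the arc of [p], flatness reads [e.1 * s + e.2 * g * D s = O(s^2)] for the increment [D] of
    the height. Adding the cases [t] and [- t] cancels the linear term, so [D t + D (- t) = O(t^2)];
    squaring [f0 + D] carries this over to [height2], hence to [k]. *)
Lemma flat_second_difference p (e : plane) (M d : R) : rim k p -> `|p.1| < 1 ->
  enorm e = 1 -> 0 < M -> 0 < d ->
  (forall q, rim k q -> enorm (q - p) < d ->
      `|dot e (q - p)| <= M * enorm (q - p) ^+ 2) ->
  exists M' d' : R, [/\ 0 < M', 0 < d' & forall t, 0 <= t < d' ->
    k (p.1 + t) + k (p.1 - t) - 2 * k p.1 <= M' * t ^+ 2].
Proof.
move=> pS p1 en M0 d0 flat; have [g g1 pE] := rim_snd pS.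
have gn : `|g| = 1.
  by apply/eqP; rewrite -(eqrXn2 (n := 2)) // expr1n real_normK ?num_real // g1.
have [_ _ kl _] := Hk.
pose f0 := height k p.1; have f00 : 0 < f0 by exact: height_gt0.
(* Increments of [height2] are at most [4 * |s|], and dividing by a sum of heights costs at most
   [1 / f0]. *)
pose L := 4 / f0; have L0 : 0 < L by rewrite divr_gt0.
pose D s := height k (p.1 + s) - f0.
have in1 s : `|s| <= 1 - `|p.1| -> `|p.1 + s| <= 1.
  by move=> s1; apply: le_trans (ler_normD _ _) _; rewrite -lerBrDl.
have D_lip s : `|s| <= 1 - `|p.1| -> `|D s| <= L * `|s|.
  move=> s1; have hs : 0 < height k (p.1 + s) + f0 by rewrite ltr_wpDl // sqrtr_ge0.
  have : `|D s * (height k (p.1 + s) + f0)| <= 4 * `|s|.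
    rewrite /D -subr_sqr (sqr_height Hk (in1 _ s1)) (sqr_height Hk (ltW p1)).
    have -> : height2 k (p.1 + s) - height2 k p.1 =
        - (p.1 + (p.1 + s)) * s + (k (p.1 + s) - k p.1).
      by rewrite /height2; ring.
    apply: le_trans (ler_normD _ _) _; rewrite normrM normrN.
    have h1 : `|p.1 + (p.1 + s)| <= 2.
      apply: le_trans (ler_normD _ _) _.
      by have := in1 _ s1; move: p1 => /ltW; lra.
    have h2 := kl (p.1 + s) p.1; rewrite addrAC subrr add0r in h2.
    have h3 : `|p.1 + (p.1 + s)| * `|s| <= 2 * `|s| by rewrite ler_wpM2r.
    have := normr_ge0 s; lra.
  rewrite normrM [`|height k _ + f0|]gtr0_norm // => h1.
  rewrite /L mulrAC ler_pdivlMr //; apply: le_trans h1.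
  by rewrite ler_wpM2l // lerDr sqrtr_ge0.
pose q s : plane := (p.1 + s, g * height k (p.1 + s)).
have q_rim s : `|s| <= 1 - `|p.1| -> rim k (q s).
  by move=> s1; apply: rim_graph => //; exact: in1.
have qpE s : q s - p = (s, g * D s).
  rewrite [p in LHS]surjective_pairing pE.
  change ((p.1 + s - p.1, g * height k (p.1 + s) - g * height k p.1) = (s, g * D s)).
  by rewrite -mulrBr [p.1 + s - _]addrAC subrr add0r.
have q_norm s : `|s| <= 1 - `|p.1| -> enorm (q s - p) ^+ 2 <= (1 + L ^+ 2) * s ^+ 2.
  move=> s1; rewrite qpE sqr_enorm /= exprMn g1 mul1r mulrDl mul1r lerD2l.
  rewrite -exprMn -real_normK ?num_real // -[leRHS]real_normK ?num_real //.
  rewrite ler_pXn2r ?nnegrE // normrM [`|L|]gtr0_norm //; exact: D_lip.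
have K0 : 0 < 1 + L ^+ 2 by rewrite ltr_pwDl // sqr_ge0.
pose M1 := M * (1 + L ^+ 2); have M10 : 0 < M1 by exact: mulr_gt0.
pose d1 := Num.min (1 - `|p.1|) (d / (1 + L)).
have L1 : 0 < 1 + L by rewrite addr_gt0.
have d10 : 0 < d1 by rewrite lt_min subr_gt0 p1 divr_gt0.
have line s : `|s| < d1 -> `|e.1 * s + e.2 * g * D s| <= M1 * s ^+ 2.
  rewrite lt_min => /andP[/ltW s1]; rewrite ltr_pdivlMr // mulrC => sd.
  have qd : enorm (q s - p) < d.
    rewrite qpE; apply: le_lt_trans (enorm_leD _) _; apply: le_lt_trans sd.
    by rewrite /= normrM gn mul1r mulrDl mul1r lerD2l; exact: D_lip.
  have := flat _ (q_rim s s1) qd; rewrite {1}qpE /dot /= mulrA => h1.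
  by apply: le_trans h1 _; rewrite /M1 -mulrA ler_pM2l //; exact: q_norm.
(* A horizontal [e] would give [|s| <= M1 * s^2] for all small [s]. *)
have e20 : e.2 != 0.
  apply: contra_eq_neq en => e2; have : `|e.1| = enorm e.
    apply/eqP; rewrite -(eqrXn2 (n := 2)) ?enorm_ge0 // sqr_enorm e2 expr0n addr0.
    by rewrite real_normK ?num_real.
  move=> <-; apply/negP => /eqP e11.
  pose s := Num.min (d1 / 2) ((2 * M1)^-1).
  have s0 : 0 < s by rewrite lt_min divr_gt0 //= invr_gt0 mulr_gt0.
  have sd : `|s| < d1.
    rewrite gtr0_norm // (@le_lt_trans _ _ (d1 / 2)) ?ge_min ?lexx //.
    by rewrite ltr_pdivrMr // ltr_pMr // ltr1n.
  have := line s sd; rewrite e2 !mul0r addr0 normrM e11 mul1r gtr0_norm //.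
  rewrite expr2 mulrA ler_pMl //; apply/negP; rewrite -ltNge.
  apply: (@le_lt_trans _ _ (M1 * (2 * M1)^-1)).
    by rewrite ler_pM2l // ge_min lexx orbT.
  by rewrite invfM mulrCA mulfV ?gt_eqF // mulr1 invf_lt1 // ltr1n.
pose M2 := 2 * M1 / `|e.2|.
have M20 : 0 <= M2 by rewrite divr_ge0 // ltW // mulr_gt0.
(* The three summands bound [2 * f0 * (D t + D (- t))], the two squares of increments, and the
   second difference of [x^2]. *)
exists (2 * f0 * M2 + 2 * L ^+ 2 + 2), d1; split => //.
  have := mulr_ge0 (ltW f00) M20; have := sqr_ge0 L; lra.
move=> t /andP[t0 td].
have tn : `|t| < d1 by rewrite ger0_norm.
have Nt : `|- t| < d1 by rewrite normrN.
have DD : `|D t + D (- t)| <= M2 * t ^+ 2.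
  rewrite /M2 mulrAC ler_pdivlMr ?normr_gt0 // mulrC.
  have -> : `|e.2| = `|e.2 * g| by rewrite normrM gn mulr1.
  rewrite -normrM.
  have -> : e.2 * g * (D t + D (- t)) =
    (e.1 * t + e.2 * g * D t) + (e.1 * (- t) + e.2 * g * D (- t)) by ring.
  apply: le_trans (ler_normD _ _) _.
  have -> : 2 * M1 * t ^+ 2 = M1 * t ^+ 2 + M1 * t ^+ 2 by ring.
  by apply: lerD; [exact: line|have := line _ Nt; rewrite sqrrN].
have t1 : `|t| <= 1 - `|p.1| by apply/ltW; move: tn; rewrite lt_min => /andP[].
have Nt1 : `|- t| <= 1 - `|p.1| by rewrite normrN.
have sqD s : `|s| <= 1 - `|p.1| -> D s ^+ 2 <= L ^+ 2 * s ^+ 2.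
  move=> s1; rewrite -exprMn -real_normK ?num_real // -[leRHS]real_normK ?num_real //.
  rewrite ler_pXn2r ?nnegrE // normrM [`|L|]gtr0_norm //; exact: D_lip.
have D2 := sqD _ t1; have := sqD _ Nt1; rewrite sqrrN => D2N.
have hE s : `|s| <= 1 - `|p.1| -> height2 k (p.1 + s) = (f0 + D s) ^+ 2.
  by move=> s1; rewrite -(sqr_height Hk (in1 _ s1)) /D [f0 + _]addrC subrK.
have := hE _ t1; have := hE _ Nt1; have := sqr_height Hk (ltW p1).
rewrite -/f0 /height2 => w0 wN w.
have h3 : 2 * f0 * (D t + D (- t)) <= 2 * f0 * (M2 * t ^+ 2).
  rewrite ler_pM2l ?mulr_gt0 //; exact: le_trans (ler_norm _) DD.
by lra.
Qed.

(** At step [2 * r], with [r] the distance to a kink of size [c], the second difference is at least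
    [2 * c * r], whereas flatness bounds it by [4 * M * r^2]. If [r = 0], any small step gives the
    contradiction. *)
Lemma curvature_not_defined p : rim k p -> `|p.1| < 1 ->
  (forall M : R, exists q c, [/\ 0 < c, kink k q c & M * `|p.1 - q| < c]) ->
  ~ curvature_defined (rim k) p.
Proof.
move=> pS p1 approx /(curvature_defined_flat pS p1)[e [M0 [d0 [en M00 d00 flat]]]].
have [M [d [Mpos dpos second]]] := flat_second_difference pS p1 en M00 d00 flat.
(* The summand [2 * M] defeats the quadratic bound; [d^-1], together with [c <= 1/4], makes the step
   [2 * r] smaller than [d]. *)
have [q [c [c0 kq qc]]] := approx (2 * M + d^-1).
pose r := `|p.1 - q|.
have c1 : c <= 4^-1.
  have := kq q 1 ler01; rewrite subrr normr0 subr0 mulr1.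
  have [_ _ kl _] := Hk.
  have := le_trans (ler_norm _) (kl (q + 1) q).
  have := le_trans (ler_norm _) (kl (q - 1) q).
  have -> : q - 1 - q = - 1 by ring.
  have -> : q + 1 - q = 1 by ring.
  by rewrite normrN normr1; lra.
have r0 : 0 <= r by exact: normr_ge0.
have di : 0 < d^-1 by rewrite invr_gt0.
have rc : 2 * M * r < c.
  by apply: le_lt_trans qc; rewrite ler_wpM2r // lerDl ltW.
have rd : 2 * r < d.
  have : d^-1 * r < c.
    by apply: le_lt_trans qc; rewrite ler_wpM2r // lerDr mulr_ge0 // ltW.
  rewrite ltr_pdivrMl // => h1.
  have : d * c <= d * 4^-1 by rewrite ler_pM2l.
  by lra.
have := r0; rewrite le_eqVlt => /predU1P[rE|rpos].
  pose t := Num.min (d / 2) (c / M).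
  have t0 : 0 < t by rewrite lt_min !divr_gt0.
  have td : t < d.
    rewrite (@le_lt_trans _ _ (d / 2)) ?ge_min ?lexx //.
    by rewrite ltr_pdivrMr // ltr_pMr // ltr1n.
  have tc : M * t <= c by rewrite mulrC -ler_pdivlMr // ge_min lexx orbT.
  have := second t; rewrite (ltW t0) td => /(_ isT).
  have := kq p.1 t (ltW t0); rewrite -/r -rE subr0 => h1 h2.
  have := le_trans h1 h2; rewrite expr2 mulrA ler_pM2r //.
  by lra.
have := second (2 * r); rewrite mulr_ge0 // rd => /(_ isT).
have := kq p.1 (2 * r); rewrite mulr_ge0 // => /(_ isT); rewrite -/r => h1 h2.
have := le_trans h1 h2.
have -> : 2 * c * (2 * r - r) = 2 * c * r by ring.
have -> : M * (2 * r) ^+ 2 = 2 * (2 * M * r) * r by ring.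
by rewrite ler_pM2r //; lra.
Qed.

End rim_curvature.

(** * Lower bounds on Hausdorff dimension *)

Section hausdorff_lower_bound.
Context {R : realType}.
Local Notation plane := (R * R)%type.

(** Lowering the exponent from [1/n] to [s] increases powers of [b <= 1], so a Hoelder bound holds
    for every smaller exponent too. *)
Lemma le_powR_of_expr (a b : R) (n : nat) (s : R) : (0 < n)%N -> 0 <= s <= n%:R^-1 ->
  0 <= a -> 0 <= b <= 1 -> forall K : R, 0 <= K -> a ^+ n <= K * b ->
  a <= K `^ n%:R^-1 * b `^ s.
Proof.
move=> n0 /andP[s0 sn] a0 /andP[b0 b1] K K0 aKb.
have n0' : (n%:R : R) != 0 by rewrite pnatr_eq0 -lt0n.
have ni : 0 <= (n%:R^-1 : R) by rewrite invr_ge0.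
have -> : a = (a ^+ n) `^ n%:R^-1 by rewrite -powR_mulrn // -powRrM mulfV // powRr1.
apply: (@le_trans _ _ ((K * b) `^ n%:R^-1)).
  by apply: ge0_ler_powR; rewrite ?nnegrE ?exprn_ge0 ?mulr_ge0.
rewrite powRM // ler_wpM2l ?powR_ge0 //.
move: b0; rewrite le_eqVlt => /predU1P[<-|b0].
  by rewrite powR0 ?powR_ge0 // invr_eq0.
by apply: ger_powR => //; rewrite b0.
Qed.

Lemma diam_ge (U : set plane) x y : U x -> U y -> ((enorm (x - y))%:E <= diam U)%E.
Proof. by move=> Ux Uy; apply: ereal_sup_ubound; exists x => //; exists y. Qed.

(* The sets [F @^-1` U k] are contained in intervals of length
   [2 K (diam (U k))^s], which cover [0, 1]. *)
Lemma holder_cover_sum_ge (F : R -> plane) (K s : R) (U : (set plane)^nat) :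
  0 < K ->
  (forall d, 0 <= d <= 1 -> forall t t', 0 <= t <= 1 -> 0 <= t' <= 1 ->
     enorm (F t - F t') <= d -> `|t - t'| <= K * d `^ s) ->
  F @` `[0, 1] `<=` \bigcup_k U k -> (forall k, diam (U k) <= 1%:E)%E ->
  ((2 * K)^-1%:E <= \sum_(k <oo | U k != set0) poweR (diam (U k)) s)%E.
Proof.
move=> K0 FK FU U1.
have diam_fin k t : F t \in U k -> exists2 d, 0 <= d <= 1 & diam (U k) = d%:E.
  move=> /set_mem Ut; have := diam_ge Ut Ut; rewrite subrr enorm0; have := U1 k.
  by case: (diam (U k)) => [d| |] // d1 d0; exists d; rewrite // -!lee_fin d0.
have /choice[I IP] : forall k, exists I : set R, [/\ measurable I,
    (forall t, 0 <= t <= 1 -> U k (F t) -> I t) &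
    (lebesgue_measure I <=
      if U k != set0 then (2 * K)%:E * poweR (diam (U k)) s else 0)%E].
  move=> k; have [[t [t01 Ut]]|nt] :=
      pselect (exists t, 0 <= t <= 1 /\ U k (F t)); last first.
    exists set0; split=> //; first by move=> t t01 Ut; apply: nt; exists t.
    rewrite measure0; case: ifP => // _.
    by rewrite mule_ge0 ?poweR_ge0 // lee_fin mulr_ge0 // ltW.
  have [d d01 dE] := diam_fin k t (mem_set Ut).
  pose l := K * d `^ s.
  have l0 : 0 <= l by rewrite mulr_ge0 ?powR_ge0 // ltW.
  exists `[t - l, t + l]%classic; split.
  - exact: measurable_itv.
  - move=> t' t'01 Ut'; rewrite /= in_itv /= -ler_distlC.
    apply: FK => //; rewrite -lee_fin -dE; exact: diam_ge.
  - have -> : U k != set0 by apply/set0P; exists (F t).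
    rewrite dE poweR_EFin -EFinM lebesgue_measure_itv /= lte_fin.
    case: ifP => _; last by rewrite lee_fin !mulr_ge0 ?powR_ge0 // ltW.
    by rewrite -EFinB lee_fin /l; lra.
have cover : `[0, 1]%classic `<=` \bigcup_k I k.
  move=> t; rewrite /= in_itv /= => t01.
  have [k _ Ut] : (\bigcup_k U k) (F t) by apply: FU; exists t.
  by exists k => //; have [_ It _] := IP k; exact: It.
have : (lebesgue_measure `[0%R, 1%R]%classic <= \sum_(k <oo) lebesgue_measure (I k))%E.
  apply: measure_sigma_subadditive => //= k; by have [] := IP k.
rewrite lebesgue_measure_itv /= lte_fin ltr01 -EFinB subr0 => sum1.
rewrite eseries_mkcond.
have pos k : (0 <= if U k != set0 then poweR (diam (U k)) s else 0)%E.
  by case: ifP => // _; exact: poweR_ge0.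
have K2 : 0 < 2 * K by rewrite mulr_gt0.
rewrite -[leLHS]mule1 lee_pdivrMl // -nneseriesZl; last by move=> k _; exact: pos.
apply: le_trans sum1 _; apply: lee_nneseries => // k _.
have [_ _ Ik] := IP k; apply: le_trans Ik _.
by case: ifP => // _; rewrite mule0.
Qed.

(** For [s] below [1/n], already the content at scale 1 is positive. That scale is chosen so that
    diameters are at most 1 and the exponent [1/n] may be lowered to [s]. *)
Lemma hausdorff_dim_holder_ge (F : R -> plane) (K : R) (n : nat) : 0 < K -> (0 < n)%N ->
  (forall t t', 0 <= t <= 1 -> 0 <= t' <= 1 ->
     `|t - t'| ^+ n <= K * enorm (F t - F t')) ->
  ((n%:R^-1)%:E <= hausdorff_dim (F @` `[0%R, 1%R]))%E.
Proof.
move=> K0 n0 FK; apply: le_ereal_inf_tmp => _ [s [s0 Hs] <-].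
rewrite lee_fin leNgt; apply/negP => sn.
pose L := K `^ n%:R^-1; have L0 : 0 < L by exact: powR_gt0.
suff : ((2 * L)^-1%:E <= hausdorff_measure s (F @` `[0%R, 1%R]))%E.
  by rewrite Hs lee_fin leNgt invr_gt0 mulr_gt0.
apply: le_ereal_sup_tmp; exists (hausdorff_content s 1 (F @` `[0%R, 1%R])).
  by exists 1 => //=; exact: ltr01.
apply: le_ereal_inf_tmp => _ [U [FU U1] <-].
apply: (@holder_cover_sum_ge F) => // d d01 t t' t01 t'01 Fd.
apply: le_powR_of_expr n0 _ _ d01 _ (ltW K0) _ => //; first by rewrite s0 ltW.
by apply: le_trans (FK _ _ t01 t'01) _; rewrite ler_pM2l.
Qed.

End hausdorff_lower_bound.

(** * Bounds on limits and convergence by geometric majorants *)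

Section sequences_lemmas.
Context {R : realType}.

Lemma cvgn_ge (u : nat -> R) (l a : R) (N : nat) : u n @[n --> \oo] --> l ->
  (forall n, (N <= n)%N -> a <= u n) -> a <= l.
Proof.
move=> ul au; rewrite -(cvg_lim _ ul) //; apply: limr_ge; first exact: cvgP ul.
by near=> n; apply: au; near: n; exact: nbhs_infty_ge.
Unshelve. all: by end_near. Qed.

Lemma is_cvg_series_geometric_bound (u : nat -> R) (C z : R) : 0 <= z < 1 ->
  (forall n, `|u n| <= C * z ^+ n) -> cvgn (series u).
Proof.
move=> /andP[z0 z1] uC; apply: normed_cvg.
have C0 : 0 <= C by have := uC 0; rewrite expr0 mulr1; exact: le_trans.
apply: (@series_le_cvg _ (fun n => `|u n|) (geometric C z)).
- by [].
- by move=> n; rewrite /geometric mulr_ge0 ?exprn_ge0.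
- exact: uC.
- by apply: is_cvg_geometric_series; rewrite ger0_norm.
Qed.

End sequences_lemmas.

(** * Convex functions with prescribed kinks *)

Section kink_series.
Context {R : realType}.
Variable s : nat -> seq R.
Hypothesis size_s : forall m, (size (s m) <= 3 * 2 ^ m)%N.
Hypothesis s_le1 : forall m q, q \in s m -> `|q| <= 1.

(* The affine part makes every term vanish at [-1] and [1]. *)
Definition hat (q x : R) : R := `|x - q| - 1 + q * x.

(* The factor [72] bounds the Lipschitz constant of the sum by [1/4].  The
   ratio [3] exceeds the growth rate [2] of the number of kinks and is less than
   the rate [4] at which they approximate the range of [stair] below. *)
Definition kink_weight (m : nat) : R := 72^-1 * 3^-1 ^+ m.

Definition kink_term (x : R) (m : nat) : R :=
  kink_weight m * \sum_(q <- s m) hat q x.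

Definition kink_series (x : R) : R := limn (series (kink_term x)).

Lemma kink_weight_gt0 m : 0 < kink_weight m.
Proof. by rewrite mulr_gt0 ?invr_gt0 ?exprn_gt0. Qed.

Lemma hat_lip (q x y : R) : `|q| <= 1 -> `|hat q x - hat q y| <= 2 * `|x - y|.
Proof.
move=> q1; have -> : hat q x - hat q y = (`|x - q| - `|y - q|) + q * (x - y).
  by rewrite /hat; ring.
apply: le_trans (ler_normD _ _) _; rewrite normrM mulr_natl mulr2n.
apply: lerD; last by rewrite ler_piMl.
apply: le_trans (ler_dist_dist _ _) _.
by have -> : x - q - (y - q) = x - y by ring.
Qed.

Lemma hat1 (q e : R) : e ^+ 2 = 1 -> `|q| <= 1 -> hat q e = 0.
Proof.
rewrite ler_norml => /eqP; rewrite sqrf_eq1 => /orP[]/eqP-> /andP[q1 q2]; rewrite /hat.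
  by rewrite ger0_norm; lra.
by rewrite ler0_norm; lra.
Qed.

Lemma hat_convex (q : R) : convex3 (hat q).
Proof.
move=> x y z xy yz; rewrite /hat.
suff : `|y - q| * (z - x) <= `|x - q| * (z - y) + `|z - q| * (y - x) by lra.
have h1 : `|(x - q) * (z - y)| = `|x - q| * (z - y).
  by rewrite normrM [`|z - y|]ger0_norm ?subr_ge0.
have h2 : `|(z - q) * (y - x)| = `|z - q| * (y - x).
  by rewrite normrM [`|y - x|]ger0_norm ?subr_ge0.
have h3 : `|(y - q) * (z - x)| = `|y - q| * (z - x).
  by rewrite normrM [`|z - x|]ger0_norm ?subr_ge0 // (le_trans xy).
rewrite -h1 -h2 -h3.
have -> : (y - q) * (z - x) = (x - q) * (z - y) + (z - q) * (y - x) by ring.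
exact: ler_normD.
Qed.

(** The affine part cancels, and [|a + t| + |a - t|] is at least both [2 * |a|] and [2 * t]. The
    first bound lets all other hats be discarded, the second is the kink itself. *)
Lemma hat_second_diff (q x t : R) : 0 <= t ->
  0 <= hat q (x + t) + hat q (x - t) - 2 * hat q x /\
  2 * (t - `|x - q|) <= hat q (x + t) + hat q (x - t) - 2 * hat q x.
Proof.
move=> t0; rewrite /hat; set a := x - q.
have -> : x + t - q = a + t by rewrite /a; ring.
have -> : x - t - q = a - t by rewrite /a; ring.
have := ler_normD (a + t) (a - t); have := ler_normB (a + t) (a - t).
have -> : a + t - (a - t) = 2 * t by ring.
have -> : a + t + (a - t) = 2 * a by ring.
have -> : `|2 * t| = 2 * t by rewrite ger0_norm ?mulr_ge0.
have -> : `|2 * a| = 2 * `|a| by rewrite normrM ger0_norm.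
by move=> h1 h2; split; lra.
Qed.

(** At most [3 * 2^m] hats, each 2-Lipschitz, with weight [3^-m / 72]. These constants add up to
    [1/12 * 3 = 1/4]. *)
Lemma kink_term_lip (x y : R) (m : nat) :
  `|kink_term x m - kink_term y m| <= 12^-1 * (2 / 3) ^+ m * `|x - y|.
Proof.
rewrite /kink_term -mulrBr -sumrB normrM (gtr0_norm (kink_weight_gt0 m)).
have le_sum : `|\sum_(q <- s m) (hat q x - hat q y)| <= (3 * 2 ^ m)%:R * (2 * `|x - y|).
  apply: le_trans (ler_norm_sum _ _ _) _.
  apply: (@le_trans _ _ (\sum_(q <- s m) 2 * `|x - y|)).
    by rewrite big_seq [leRHS]big_seq; apply: ler_sum => q /s_le1; exact: hat_lip.
  rewrite big_const_seq count_predT iter_addr_0 -[leLHS]mulr_natl ler_wpM2r ?mulr_ge0 //.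
  by rewrite ler_nat.
apply: le_trans (ler_wpM2l (ltW (kink_weight_gt0 m)) le_sum) _.
rewrite /kink_weight natrM natrX exprMn; move: (3^-1 ^+ m) (2 ^+ m) => a b.
by rewrite le_eqVlt; apply/predU1P; left; field.
Qed.

Lemma kink_term1 (e : R) (m : nat) : e ^+ 2 = 1 -> kink_term e m = 0.
Proof.
move=> e1; rewrite /kink_term big_seq big1 ?mulr0 // => q /s_le1; exact: hat1.
Qed.

Lemma cvg_kink_series (x : R) :
  series (kink_term x) n @[n --> \oo] --> kink_series x.
Proof.
apply: (@is_cvg_series_geometric_bound _ _ (12^-1 * `|x - 1|) (2 / 3)).
  by apply/andP; split; lra.
move=> n; have := kink_term_lip x 1 n; rewrite (kink_term1 n (expr1n _ 2)) subr0.
by rewrite mulrAC.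
Qed.

Lemma kink_series_lip : lip 4^-1 kink_series.
Proof.
move=> x y.
have h : 4^-1 * `|x - y| - `|series (kink_term x) n - series (kink_term y) n| @[n --> \oo]
    --> 4^-1 * `|x - y| - `|kink_series x - kink_series y|.
  apply: cvgB; first exact: cvg_cst.
  by apply: cvg_norm; apply: cvgB; exact: cvg_kink_series.
rewrite -subr_ge0; apply: (cvgn_ge (N := 0)) h _ => n _; rewrite subr_ge0.
suff : `|series (kink_term x) n - series (kink_term y) n| <=
    4^-1 * (1 - (2 / 3) ^+ n) * `|x - y|.
  move=> /le_trans; apply; rewrite ler_wpM2r // ler_piMr // gerBl exprn_ge0 //.
elim: n => [|n IH];
  first by rewrite /series /= !big_geq // subrr normr0 expr0 subrr mulr0 mul0r.
rewrite /series /= !big_nat_recr //= -![\sum_(0 <= _ < n) _]/(series _ n).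
rewrite opprD addrACA; apply: le_trans (ler_normD _ _) _.
apply: le_trans (lerD IH (kink_term_lip x y n)) _.
rewrite exprS; move: ((2 / 3) ^+ n) => a.
by rewrite le_eqVlt; apply/predU1P; left; field.
Qed.

Lemma kink_series1 (e : R) : e ^+ 2 = 1 -> kink_series e = 0.
Proof.
move=> e1; have -> : kink_series e = limn (series (fun=> 0 : R)).
  by congr (limn (series _)); apply/funext => m; exact: kink_term1.
by apply/cvg_lim => //; rewrite /series /=;
  under eq_fun do rewrite big1 //; exact: cvg_cst.
Qed.

Lemma kink_series_convex : convex3 kink_series.
Proof.
move=> x y z xy yz; rewrite -subr_ge0.
have h : series (kink_term x) n * (z - y) + series (kink_term z) n * (y - x)
    - series (kink_term y) n * (z - x) @[n --> \oo] -->
    kink_series x * (z - y) + kink_series z * (y - x) - kink_series y * (z - x).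
  apply: cvgB; last by apply: cvgM; [exact: cvg_kink_series|exact: cvg_cst].
  by apply: cvgD; (apply: cvgM; [exact: cvg_kink_series|exact: cvg_cst]).
apply: (cvgn_ge (N := 0)) h _ => n _; rewrite /series /= !mulr_suml.
rewrite -big_split -sumrB /=; apply: sumr_ge0 => m _; rewrite /kink_term.
move: (kink_weight m) (kink_weight_gt0 m) => c /ltW c0.
rewrite -!mulrA -mulrDr -mulrBr mulr_ge0 //.
rewrite !mulr_suml -big_split -sumrB /=; apply: sumr_ge0 => q _.
by rewrite subr_ge0; exact: hat_convex.
Qed.

Lemma profile_kink_series : profile kink_series.
Proof.
split; [|
  |exact: kink_series_lip|exact: kink_series_convex]; rewrite kink_series1 //.
  by rewrite expr1n.
by rewrite sqrrN expr1n.
Qed.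

(** Every partial sum that includes level [m] has a second difference at least that of the single
    weighted hat at [q], all others being nonnegative. *)
Lemma kink_kink_series (m : nat) (q : R) : q \in s m ->
  kink kink_series q (kink_weight m).
Proof.
move=> qs x t t0.
have h : series (kink_term (x + t)) n + series (kink_term (x - t)) n
    - 2 * series (kink_term x) n @[n --> \oo] -->
    kink_series (x + t) + kink_series (x - t) - 2 * kink_series x.
  apply: cvgB; first by apply: cvgD; exact: cvg_kink_series.
  by apply: cvgM; [exact: cvg_cst|exact: cvg_kink_series].
apply: (cvgn_ge (N := m.+1)) h _ => n mn.
pose sd q' := hat q' (x + t) + hat q' (x - t) - 2 * hat q' x.
have sd0 q' : 0 <= sd q' by have [] := hat_second_diff q' x t0.
have -> : series (kink_term (x + t)) n + series (kink_term (x - t)) n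
    - 2 * series (kink_term x) n =
    \sum_(0 <= j < n) kink_weight j * \sum_(q' <- s j) sd q'.
  rewrite /series /= mulr_sumr -big_split -sumrB /=; apply: eq_bigr => j _.
  rewrite /kink_term mulrCA -mulrDr -mulrBr; congr (_ * _).
  by rewrite mulr_sumr -big_split -sumrB.
rewrite (bigD1_seq m) ?mem_index_iota ?iota_uniq //=.
rewrite ler_wpDr //.
  by apply: sumr_ge0 => j _; rewrite mulr_ge0 ?(ltW (kink_weight_gt0 j)) // sumr_ge0.
rewrite [2 * _]mulrC -mulrA ler_pM2l ?kink_weight_gt0 //.
rewrite (big_rem q) //= ler_wpDr ?sumr_ge0 //.
by have [] := hat_second_diff q x t0.
Qed.

End kink_series.

(** * A Cantor-like set approximated by kinks *)

Section cantor_set.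
Context {R : realType}.

Definition stair_term (t : R) (m : nat) : R :=
  (Num.floor (2 ^+ m * t))%:~R / 8 ^+ m.+1.

(* [stair] jumps by at least [8^-(n+1)] at the dyadic numbers of level [n], so
   its inverse is Hoelder continuous with exponent [1/3]. *)
Definition stair (t : R) : R := limn (series (stair_term t)).

Lemma stair_term_ge0 t m : 0 <= t -> 0 <= stair_term t m.
Proof.
by move=> t0; rewrite divr_ge0 ?exprn_ge0 // ler0z floor_ge0 mulr_ge0 ?exprn_ge0.
Qed.

Lemma stair_term_le t m : t <= 1 -> stair_term t m <= 8^-1 * 4^-1 ^+ m.
Proof.
move=> t1; rewrite ler_pdivrMr ?exprn_gt0 //; apply: le_trans (floor_le _) _.
have -> : 8^-1 * 4^-1 ^+ m * 8 ^+ m.+1 = 2 ^+ m :> R.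
  rewrite exprS mulrACA mulVf ?pnatr_eq0 // mul1r -exprMn; congr (_ ^+ _).
  by field.
by rewrite ler_piMr // exprn_ge0.
Qed.

Lemma stair_term_mono t t' m : t <= t' -> stair_term t m <= stair_term t' m.
Proof.
move=> tt'; rewrite ler_pM2r ?invr_gt0 ?exprn_gt0 // ler_int le_floor //.
by rewrite ler_pM2l ?exprn_gt0.
Qed.

Lemma series_stair_le t n : t <= 1 ->
  series (stair_term t) n <= 6^-1 * (1 - 4^-1 ^+ n).
Proof.
move=> t1; elim: n => [|n IH].
  by rewrite /series /= big_geq // expr0 subrr mulr0.
rewrite /series /= big_nat_recr //= -[\sum_(0 <= _ < n) _]/(series _ n).
have := stair_term_le n t1; rewrite exprS => h; lra.
Qed.

Lemma cvg_stair t : 0 <= t <= 1 -> series (stair_term t) n @[n --> \oo] --> stair t.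
Proof.
move=> /andP[t0 t1]; apply: (@is_cvg_series_geometric_bound _ _ 8^-1 4^-1).
  by apply/andP; split; lra.
by move=> n; rewrite ger0_norm ?stair_term_ge0 // stair_term_le.
Qed.

(** The terms are nonnegative and at most [4^-m / 8], so the tail from [n] on is at most
    [4^-n / 6]. *)
Lemma stair_approx t n : 0 <= t <= 1 ->
  `|stair t - series (stair_term t) n| <= 4^-1 ^+ n.
Proof.
move=> t01; have /andP[t0 t1] := t01.
have bounds N : (n <= N)%N -> series (stair_term t) n <= series (stair_term t) N <=
    series (stair_term t) n + (4^-1 ^+ n - 4^-1 ^+ N) / 6.
  elim: N => [|N IH]; first by rewrite leqn0 => /eqP ->; rewrite subrr mul0r addr0 lexx.
  rewrite leq_eqVlt => /predU1P[->|]; first by rewrite subrr mul0r addr0 lexx.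
  rewrite ltnS => /IH /andP[h1 h2].
  rewrite [series _ N.+1]/series /= big_nat_recr //= -[\sum_(0 <= _ < N) _]/(series _ N).
  have := stair_term_ge0 N t0; have := stair_term_le N t1; rewrite exprS => h3 h4.
  by apply/andP; split; lra.
have n0 : 0 <= 4^-1 ^+ n :> R by rewrite exprn_ge0.
rewrite ler_norml; apply/andP; split.
  rewrite lerBrDr; apply: (cvgn_ge (N := n)) (cvg_stair t01) _ => N /bounds/andP[h _].
  by lra.
rewrite lerBlDr -lerN2; apply: (cvgn_ge (N := n)); first by apply: cvgN; exact: cvg_stair.
move=> N /bounds/andP[_ h]; rewrite lerN2.
have : 0 <= 4^-1 ^+ N :> R by rewrite exprn_ge0.
by lra.
Qed.

Lemma stair_bounds t : 0 <= t <= 1 -> 0 <= stair t <= 6^-1.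
Proof.
move=> t01; have /andP[t0 t1] := t01; apply/andP; split.
  apply: (cvgn_ge (N := 0)) (cvg_stair t01) _ => n _.
  by apply: sumr_ge0 => m _; exact: stair_term_ge0.
rewrite -lerN2; apply: (cvgn_ge (N := 0)); first by apply: cvgN; exact: cvg_stair.
move=> n _; rewrite lerN2; apply: le_trans (series_stair_le n t1) _.
by rewrite ler_piMr // gerBl exprn_ge0.
Qed.

(** Let [n] be least with [2^-n <= d], where [d = t - t' > 0]. The floors of level [n] differ, so
    [stair] grows by at least [8^-(n+1)]. By minimality, or by [d <= 1] when [n = 0],
    [d <= 2 * 2^-n], whence [d^3 <= 8 * 8^-n = 64 * 8^-(n+1)]. *)
Lemma stair_expanding t t' : 0 <= t <= 1 -> 0 <= t' <= 1 ->
  `|t - t'| ^+ 3 <= 64 * `|stair t - stair t'|.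
Proof.
wlog tt' : t t' / t' < t => [wl|t01 t'01].
  have [lt|lt|->] := ltgtP t' t; first exact: wl.
    by move=> t01 t'01; rewrite distrC [`|stair t - _|]distrC; exact: wl.
  by rewrite !subrr !normr0 expr0n mulr0.
pose d := t - t'; have d0 : 0 < d by rewrite subr_gt0.
have d1 : d <= 1 by rewrite /d; move: t01 t'01 => /andP[_ ?] /andP[? _]; lra.
have exn : exists n : nat, 2^-1 ^+ n <= d.
  have : 2^-1 ^+ n @[n --> \oo] --> (0 : R).
    by apply: cvg_expr; rewrite ger0_norm // invf_lt1 // ltr1n.
  move=> /cvgr_le/(_ _ d0)[N _ /(_ N)] h; exists N; apply: h; exact: leqnn.
have [n nd nmin] := ex_minnP exn.
have dn : d <= 2 * 2^-1 ^+ n.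
  case: n nd nmin => [|n] _ nmin; first by rewrite expr0 mulr1; lra.
  rewrite exprS mulrA mulfV ?pnatr_eq0 // mul1r leNgt; apply/negP => /ltW /nmin.
  by rewrite ltnn.
have floor_lt : Num.floor (2 ^+ n * t') < Num.floor (2 ^+ n * t).
  rewrite -lezD1 floor_ge_int intrD; apply: le_trans (lerD (floor_le _) (lexx _)) _.
  have n2 : 0 < 2 ^+ n :> R by rewrite exprn_gt0.
  have : 1 <= 2 ^+ n * d by rewrite mulrC -ler_pdivrMr // mul1r -exprVn.
  by rewrite /d; lra.
have jump : 8^-1 ^+ n.+1 <= stair t - stair t'.
  have h : series (stair_term t) N - series (stair_term t') N @[N --> \oo]
      --> stair t - stair t'.
    by apply: cvgB; exact: cvg_stair.
  apply: (cvgn_ge (N := n.+1)) h _ => N nN.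
  rewrite /series /= -sumrB (bigD1_seq n) ?mem_index_iota ?iota_uniq //= ler_wpDr //.
    by apply: sumr_ge0 => j _; rewrite subr_ge0; apply: stair_term_mono; exact: ltW.
  rewrite /stair_term -mulrBl exprVn ler_peMl ?invr_ge0 ?exprn_ge0 //.
  by rewrite -intrB ler1z -gtz0_ge1 subr_gt0.
have n80 : 0 <= 8^-1 ^+ n :> R by rewrite exprn_ge0.
have jump0 : 0 <= stair t - stair t'.
  by apply: le_trans jump; rewrite exprn_ge0.
rewrite gtr0_norm ?subr_gt0 // [`|stair t - _|]ger0_norm // -/d.
apply: (@le_trans _ _ ((2 * 2^-1 ^+ n) ^+ 3)).
  by rewrite ler_pXn2r // ?nnegrE ?ltW // (lt_le_trans d0).
rewrite exprMn -exprM mulnC exprM.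
have -> : 2^-1 ^+ 3 = 8^-1 :> R by field.
by move: jump; rewrite exprS; lra.
Qed.

(** Truncating [t] after [n] binary digits does not affect the earlier digits. Hence a partial sum
    of [stair] takes only finitely many values on [[0, 1]]. *)
Lemma floor_expr2_div (t : R) (n j : nat) : (j <= n)%N ->
  Num.floor (2 ^+ j * ((Num.floor (2 ^+ n * t))%:~R / 2 ^+ n) : R) =
  Num.floor (2 ^+ j * t).
Proof.
move=> jn; have p2 m : 0 < 2 ^+ m :> R by rewrite exprn_gt0.
apply/eqP; rewrite eq_le; apply/andP; split.
  apply: le_floor; rewrite ler_pM2l // ler_pdivrMr // mulrC; exact: floor_le.
rewrite floor_ge_int; set a := Num.floor (2 ^+ j * t).
have : (a * 2 ^+ (n - j) <= Num.floor (2 ^+ n * t)).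
  rewrite floor_ge_int intrM -(subnK jn) exprD -mulrA addnK mulrC.
  have -> : (2 ^+ (n - j) : int)%:~R = 2 ^+ (n - j) :> R by rewrite rmorphXn.
  by rewrite ler_pM2l //; exact: floor_le.
rewrite -(ler_int R) intrM => h.
rewrite mulrA ler_pdivlMr // -{1}(subnK jn) addnC exprD mulrCA ler_pM2l // mulrC.
by move: h; rewrite rmorphXn mulrC.
Qed.

(** All values of the [n]-th partial sum on [[0, 1]]; the index [2^n] accounts for the endpoint
    [t = 1]. *)
Definition stair_points (n : nat) : seq R :=
  [seq series (stair_term (i%:R / 2 ^+ n)) n | i <- iota 0 (2 ^ n).+1].

Lemma stair_points_near t n : 0 <= t <= 1 ->
  exists2 q, q \in stair_points n & `|stair t - q| <= 4^-1 ^+ n.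
Proof.
move=> t01; have /andP[t0 t1] := t01.
have p2 : 0 < 2 ^+ n :> R by rewrite exprn_gt0.
have f0 : 0 <= Num.floor (2 ^+ n * t) by rewrite floor_ge0 mulr_ge0 // ltW.
exists (series (stair_term t) n); last exact: stair_approx.
pose i := `|Num.floor (2 ^+ n * t)|%N.
have iE : (i%:R : R) = (Num.floor (2 ^+ n * t))%:~R by rewrite natr_absz ger0_norm.
apply/mapP; exists i.
  rewrite mem_iota /= add0n ltnS -(ler_nat R) iE natrX.
  apply: le_trans (floor_le _) _; by rewrite ler_piMr // ltW.
rewrite iE /series /= !big_nat; apply: eq_bigr => j /andP[_ jn].
by rewrite /stair_term floor_expr2_div // ltnW.
Qed.

Lemma stair_points_le1 n q : q \in stair_points n -> `|q| <= 1.
Proof.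
move=> /mapP[i]; rewrite mem_iota /= add0n ltnS => i2 ->.
have p2 : 0 < 2 ^+ n :> R by rewrite exprn_gt0.
have t01 : 0 <= (i%:R / 2 ^+ n : R) <= 1.
  apply/andP; split; first by rewrite divr_ge0 // ltW.
  by rewrite ler_pdivrMr // mul1r -natrX ler_nat.
have /andP[t0 t1] := t01.
rewrite ger0_norm; last by apply: sumr_ge0 => m _; exact: stair_term_ge0.
apply: le_trans (series_stair_le n t1) _.
have : 0 <= 4^-1 ^+ n :> R by rewrite exprn_ge0.
by lra.
Qed.

(** An enumeration of the rationals of [[-1, 1]]. Codes of anything else yield 0, which only adds
    further hats at 0. *)
Definition rat_point (m : nat) : R :=
  if unpickle m is Some r then (if `|ratr r : R| <= 1 then ratr r else 0) else 0.

Lemma rat_point_le1 m : `|rat_point m| <= 1.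
Proof.
rewrite /rat_point; case: unpickle => [r|]; last by rewrite normr0.
by case: ifP => // _; rewrite normr0.
Qed.

Lemma rat_point_dense (a b : R) : -1 <= a -> a < b -> b <= 1 ->
  exists m, a < rat_point m < b.
Proof.
move=> a1 ab b1; have [r] := rat_in_itvoo ab; rewrite in_itv /= => /andP[ar rb].
exists (pickle r); rewrite /rat_point pickleK ifT ?ar //.
by rewrite ler_norml (le_trans a1 (ltW ar)) (le_trans (ltW rb) b1).
Qed.

(** The rational point makes the kinks dense, the others approximate the range of [stair]. There are
    [2^m + 2 <= 3 * 2^m] of them. *)
Definition kinks (m : nat) : seq R := rat_point m :: stair_points m.

Lemma size_kinks m : (size (kinks m) <= 3 * 2 ^ m)%N.
Proof.
by rewrite /= size_map size_iota; have := expn_gt0 2 m; lia.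
Qed.

Lemma kinks_le1 m q : q \in kinks m -> `|q| <= 1.
Proof.
by rewrite inE => /predU1P[->|/stair_points_le1//]; exact: rat_point_le1.
Qed.

(** At level [m] the distance is at most [4^-m] and the size of the kink is [3^-m / 72], so any [m]
    with [(3/4)^m * 72 * (|M| + 1) < 1] will do. *)
Lemma stair_kinks (t M : R) : 0 <= t <= 1 ->
  exists q c, [/\ 0 < c, kink (kink_series kinks) q c & M * `|stair t - q| < c].
Proof.
move=> t01; have [m hm] : exists m : nat, (3 / 4) ^+ m * (72 * (`|M| + 1)) < 1 :> R.
  have M0 : 0 < 72 * (`|M| + 1) by rewrite mulr_gt0 // ltr_wpDl.
  have : (3 / 4) ^+ n @[n --> \oo] --> (0 : R).
    by apply: cvg_expr; rewrite ger0_norm; lra.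
  move=> /cvgr_lt/(_ (72 * (`|M| + 1))^-1); rewrite invr_gt0 => /(_ M0)[N _ /(_ N)] h.
  by exists N; rewrite -ltr_pdivlMr // mul1r; apply: h; exact: leqnn.
have [q qs qt] := stair_points_near m t01.
exists q, (kink_weight m); split; first exact: kink_weight_gt0.
  apply: kink_kink_series; [exact: size_kinks|exact: kinks_le1|].
  by rewrite inE qs orbT.
have n3 : 0 < 3^-1 ^+ m :> R by rewrite exprn_gt0.
apply: (@le_lt_trans _ _ ((`|M| + 1) * 4^-1 ^+ m)).
  apply: (@le_trans _ _ ((`|M| + 1) * `|stair t - q|)).
    by rewrite ler_wpM2r // ler_wpDr // ler_norm.
  by rewrite ler_wpM2l // addr_ge0.
have -> : 4^-1 ^+ m = (3 / 4) ^+ m * 3^-1 ^+ m :> R.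
  by rewrite -exprMn; congr (_ ^+ _); field.
rewrite mulrA /kink_weight ltr_pM2r // mulrC.
by rewrite -[ltRHS]mulr1 -ltr_pdivrMl ?invr_gt0 // invrK mulrCA.
Qed.

End cantor_set.

(** * The example *)

Lemma dense_kinks_kink_series (R : realType) (a b : R) : -1 <= a -> a < b -> b <= 1 ->
  exists q c, [/\ a < q < b, 0 < c & kink (kink_series kinks) q c].
Proof.
move=> a1 ab b1; have [m mab] := rat_point_dense a1 ab b1.
exists (rat_point m), (kink_weight m); split => //; first exact: kink_weight_gt0.
apply: kink_kink_series; [exact: size_kinks|exact: kinks_le1|exact: mem_head].
Qed.

Theorem theorem2 (R : realType) :
  exists (E : set (R * R)) (eps : R),
    [/\ E !=set0, compact E, 0 < eps,
        (forall x : R * R, boundary (closed_eps_nbhd eps E) x ->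
           wedge (boundary (closed_eps_nbhd eps E)) x \/
           shallow_singularity (boundary (closed_eps_nbhd eps E)) x) &
        exists C : set (R * R),
          [/\ C `<=` boundary (closed_eps_nbhd eps E),
              (0 < hausdorff_dim C)%E &
              forall x : R * R, C x ->
                ~ curvature_defined (boundary (closed_eps_nbhd eps E)) x]].
Proof.
pose k : R -> R := kink_series kinks.
have Hk : profile k by exact: profile_kink_series size_kinks kinks_le1.
exists (centers k), 2^-1.
rewrite (closed_eps_nbhd_centers Hk) (boundary_region Hk); split.
- exact: centers_nonempty.
- exact: compact_centers.
- by rewrite invr_gt0.
- move=> x; apply: rim_wedge_or_shallow => // a b.
  exact: dense_kinks_kink_series.
have stair1 t : 0 <= t <= 1 -> `|stair t : R| < 1.
  by move=> /stair_bounds/andP[h1 h2]; rewrite ger0_norm //; lra.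
(* The set [C] is the part of the upper arc above the range of [stair]. Projection to the first axis
   does not increase distances, so [F] inherits the expansion estimate of [stair]. *)
pose F t : R * R := (stair t, 1 * height k (stair t)).
have F_rim t : 0 <= t <= 1 -> rim k (F t).
  by move=> t01; apply: rim_graph; rewrite ?expr1n ?(ltW (stair1 t t01)).
exists (F @` `[0, 1]%classic); split.
- by move=> _ [t /= + <-]; rewrite in_itv /= => t01; exact: F_rim.
- have : ((3%:R^-1)%:E <= hausdorff_dim (F @` `[0%R, 1%R]))%E.
    apply: (@hausdorff_dim_holder_ge _ _ 64) => // t t' t01 t'01.
    apply: le_trans (stair_expanding t01 t'01) _; rewrite ler_pM2l //.
    exact: ler_fst_enorm (F t - F t').
  by apply: lt_le_trans; rewrite lte_fin invr_gt0.
- move=> _ [t /= + <-]; rewrite in_itv /= => t01.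
  apply: curvature_not_defined => //; [exact: F_rim|exact: stair1|].
  by move=> M; exact: stair_kinks.
Qed.
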